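(* Let $\Gamma$ be a subgroup of $\mathrm{Diff}^{\omega}_+(S^1)$ which is nondiscrete with respect to the $C^1$-topology. Then $\rho(\Gamma)\subset \mathbb{R}/\mathbb{Z}$ is a finite set if and only if $\Gamma$ has a finite orbit in $S^1$.
   Context: $\mathrm{Diff}^{\omega}_+(S^1)$ is the group of orientation-preserving real analytic diffeomorphisms of the circle $S^1=\mathbb{R}/\mathbb{Z}$. Rotation number: for $f\in\mathrm{Homeo}_+(S^1)$ choose a lift $\tilde f:\mathbb{R}\to\mathbb{R}$ (a homeomorphism commuting with integer translations); the translation number $\tau(\tilde f)=\lim_{n\to\infty}(\tilde f^n(x)-x)/n$ exists and is independent of $x$, and $\rho(f)=\tau(\tilde f) \bmod \mathbb{Z}\in\mathbb{R}/\mathbb{Z}$. ''$\Gamma$ has a finite image under the rotation number function'' means $\rho(\Gamma)$ is finite. $\Gamma$ is nondiscrete with respect to the $C^1$-topology if there is a sequence of elements of $\Gamma\setminus\{\mathrm{id}\}$ converging to the identity in the $C^1$-topology on $S^1$. A finite orbit is a point $x$ with $\Gamma x$ finite. *)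

(* Defs.v *)
From Stdlib Require Import Reals List ZArith.
Open Scope R_scope.

Definition real_analytic (f : R -> R) : Prop :=
  forall x0 : R, exists r : R, 0 < r /\ exists a : nat -> R,
    forall x : R, Rabs (x - x0) < r -> Pser a (x - x0) (f x).

(* F is a lift of an orientation-preserving real analytic diffeomorphism of
   S^1 = R/Z: real analytic, commutes with integer translation, and has
   everywhere positive derivative (so it is an increasing bijection of R
   with real analytic inverse). *)
Definition is_analytic_circle_diffeo_lift (F : R -> R) : Prop :=
  real_analytic F /\
  (forall x : R, F (x + 1) = F x + 1) /\
  (forall x : R, exists d : R, derivable_pt_lim F x d /\ 0 < d).

(* A subgroup Gamma of Diff^omega_+(S^1), represented by the set G of all
   lifts of elements of Gamma (a subgroup of the lift group containing all
   integer translations). *)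
Definition lift_subgroup (G : (R -> R) -> Prop) : Prop :=
  (forall F, G F -> is_analytic_circle_diffeo_lift F) /\
  G (fun x => x) /\
  (forall F H, G F -> G H -> G (fun x => F (H x))) /\
  (forall F, G F -> exists H, G H /\ forall x, H (F x) = x) /\
  (forall F (k : Z), G F -> G (fun x => F x + IZR k)).

Definition projects_to_id (F : R -> R) : Prop :=
  exists k : Z, forall x : R, F x = x + IZR k.

Definition translation_number (F : R -> R) (t : R) : Prop :=
  forall x : R, Un_cv (fun n => (Nat.iter (S n) F x - x) / INR (S n)) t.

Definition finite_rotation_image (G : (R -> R) -> Prop) : Prop :=
  exists L : list R, forall F t, G F -> translation_number F t ->
    exists l k, In l L /\ t = l + IZR k.

Definition has_finite_orbit (G : (R -> R) -> Prop) : Prop :=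
  exists x : R, exists L : list R, forall F, G F ->
    exists l k, In l L /\ F x = l + IZR k.

(* Gamma is nondiscrete in the C^1 topology: a sequence of non-identity
   elements converging to the identity in C^1 (suitable lifts converge to
   the identity of R uniformly together with their derivatives). *)
Definition C1_nondiscrete (G : (R -> R) -> Prop) : Prop :=
  exists Fs : nat -> R -> R,
    (forall n, G (Fs n) /\ ~ projects_to_id (Fs n)) /\
    forall eps : R, 0 < eps -> exists N : nat, forall n : nat, (N <= n)%nat ->
      forall x : R, Rabs (Fs n x - x) < eps /\
        forall d : R, derivable_pt_lim (Fs n) x d -> Rabs (d - 1) < eps.

(* Main.v *)
(* Suppose that rho(Gamma) is finite and Gamma has no finite orbit.  Positive translation
   numbers are then bounded below, so there is an M such that K^M x >= x + 1 for every
   lift K without fixed points that moves points to the right; in particular elements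
   close to the identity have fixed points.

   Take f in Gamma, not the identity, with fixed points.  As orbits are infinite, some h
   moves a fixed point e of f to a point h(e) of a component of the complement of Fix(f)
   ending at e, and the maps h f^k contract a neighbourhood of h(e) with derivative tending
   to 0.  Two such contractions have distinct fixed points, and conjugating elements
   C^1-close to the identity by suitable words in them gives elements that are as close as
   we like to small translations on a fixed interval J.

   These almost-translations first exclude proper closed invariant sets, so Gamma is minimal.
   Minimality yields a < x0 < b in J, q and H in Gamma with H(x0) > x0 and H(q) < b, where
   q is the supremum of the y such that Gamma can contract [a, y].  Let T be an
   almost-translation of size d and choose j such that T^j <= H somewhere on [a, b] but
   T^(j+1) > H on all of it.  Then K = H^-1 T^(j+1) moves all of [a, q] to the right, and
   by the choice of q it moves every point to the right; but K moves some point by O(d)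
   only, so that K^M moves it by less than 1 when d is small. *)
Require Import Defs.
From Stdlib Require Import Reals List ZArith Lra Lia Classical.
From Coquelicot Require Import Coquelicot.
Open Scope R_scope.

(** * Real analytic functions *)

(** Convergence at the point [y], halfway between [|h|] and [r], puts [h] strictly inside the disk
    of convergence: outside that disk the terms of the series do not tend to 0. *)
Lemma Pser_disk (a : nat -> R) (r : R) (f : R -> R) :
  (forall h, Rabs h < r -> Pser a h (f h)) ->
  forall h, Rabs h < r -> Rbar_lt (Rabs h) (CV_radius a) /\ f h = PSeries a h.
Proof.
intros Ha h Hh.
split.
- set (y := (Rabs h + r) / 2).
  assert (Hp := Rabs_pos h).
  assert (Hy : Rabs y < r) by (unfold y; rewrite Rabs_pos_eq; lra).
  apply Rbar_lt_le_trans with (y := Finite y); [unfold y; simpl; lra|].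
  apply Rbar_not_lt_le; intros Hc.
  apply (CV_disk_outside a y).
  + rewrite Rabs_pos_eq; [exact Hc | unfold y; lra].
  + assert (E := Ha y Hy). apply is_pseries_Reals in E.
    apply ex_series_lim_0.
    exists (f y). apply is_pseries_R. exact E.
- symmetry. apply is_pseries_unique. apply is_pseries_Reals. apply Ha, Hh.
Qed.

Lemma real_analytic_local (f : R -> R) (x0 : R) :
  real_analytic f -> exists r a, 0 < r /\
    forall x, Rabs (x - x0) < r ->
      Rbar_lt (Rabs (x - x0)) (CV_radius a) /\ f x = PSeries a (x - x0).
Proof.
intros Hf. destruct (Hf x0) as [r [Hr [a Ha]]].
exists r, a. split; [exact Hr|].
intros x Hx.
assert (H := Pser_disk a r (fun h => f (x0 + h))).
replace (f x) with (f (x0 + (x - x0))) by (f_equal; ring).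
apply H; [|exact Hx].
intros h Hh. replace h with (x0 + h - x0) at 1 by ring.
apply Ha. replace (x0 + h - x0) with h by ring. exact Hh.
Qed.

Lemma Rabs_lt_locally (x0 r x : R) :
  Rabs (x - x0) < r -> locally x (fun y => Rabs (y - x0) < r).
Proof.
intros H. assert (Hp : 0 < r - Rabs (x - x0)) by lra.
exists (mkposreal _ Hp). intros y Hy.
change (Rabs (y - x) < r - Rabs (x - x0)) in Hy.
replace (y - x0) with ((y - x) + (x - x0)) by ring.
apply Rle_lt_trans with (1 := Rabs_triang _ _). lra.
Qed.

(** Termwise differentiation of the local series; iterated, it supplies the higher derivatives
    behind the distortion bounds. *)
Lemma real_analytic_derive (f : R -> R) :
  real_analytic f -> (forall x, ex_derive f x) /\ real_analytic (Derive f).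
Proof.
intros Hf.
assert (key : forall x0, exists r a, 0 < r /\ forall x, Rabs (x - x0) < r ->
   Rbar_lt (Rabs (x - x0)) (CV_radius a) /\
   is_derive f x (PSeries (PS_derive a) (x - x0))).
{ intros x0. destruct (real_analytic_local f x0 Hf) as [r [a [Hr Ha]]].
  exists r, a. split; [exact Hr|]. intros x Hx.
  split; [apply Ha, Hx|].
  apply is_derive_ext_loc with (f := fun y => PSeries a (y - x0)).
  - generalize (Rabs_lt_locally x0 r x Hx). apply filter_imp.
    intros y Hy. symmetry. apply Ha, Hy.
  - replace (PSeries (PS_derive a) (x - x0)) with
      (scal 1 (PSeries (PS_derive a) (x - x0))) by (unfold scal; simpl; unfold mult; simpl; ring).
    apply (is_derive_comp (PSeries a) (fun y => y - x0)).
    + apply is_derive_PSeries. apply Ha, Hx.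
    + auto_derive; [exact I | ring]. }
split.
- intros x. destruct (key x) as [r [a [Hr Ha]]].
  eexists. apply Ha. replace (x - x) with 0 by ring. rewrite Rabs_R0. exact Hr.
- intros x0. destruct (key x0) as [r [a [Hr Ha]]].
  exists r. split; [exact Hr|]. exists (PS_derive a). intros x Hx.
  destruct (Ha x Hx) as [H1 H2].
  rewrite (is_derive_unique _ _ _ H2).
  apply is_pseries_Reals. apply PSeries_correct.
  apply ex_pseries_derive. exact H1.
Qed.

Lemma real_analytic_sub_id (f : R -> R) :
  real_analytic f -> real_analytic (fun x => f x - x).
Proof.
intros Hf x0. destruct (Hf x0) as [r [Hr [a Ha]]].
exists r. split; [exact Hr|].
(* The Taylor series of the identity at [x0]. *)
set (b := fun n => match n with O => x0 | S O => 1 | _ => 0 end).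
exists (PS_minus a b). intros x Hx.
apply is_pseries_Reals.
apply (is_pseries_minus a b (x - x0) (f x) x).
- apply is_pseries_Reals, Ha, Hx.
- apply is_pseries_Reals. intros eps Heps. exists 1%nat. intros n Hn.
  replace (sum_f_R0 (fun n0 => b n0 * (x - x0) ^ n0) n) with x.
  + rewrite Rdist_eq. exact Heps.
  + induction n as [|[|n] IH]; [lia| simpl; ring |].
    rewrite tech5, <- IH by lia. simpl. ring.
Qed.

Lemma first_nonzero (a : nat -> R) :
  (forall n, a n = 0) \/ exists k, a k <> 0 /\ forall i, (i < k)%nat -> a i = 0.
Proof.
destruct (classic (exists n, a n <> 0)) as [[n Hn]|H].
- right. revert Hn. induction n as [n IH] using (well_founded_induction lt_wf).
  intros Hn. destruct (classic (exists i, (i < n)%nat /\ a i <> 0)) as [[i [Hi Hai]]|Hno].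
  + apply (IH i Hi Hai).
  + exists n. split; [exact Hn|]. intros i Hi.
    destruct (Req_dec (a i) 0); [assumption|]. exfalso. apply Hno. eauto.
- left. intros n. destruct (Req_dec (a n) 0); [assumption|]. exfalso. eauto.
Qed.

Lemma continuity_pt_nonzero (g : R -> R) (x : R) :
  continuity_pt g x -> g x <> 0 ->
  exists e, 0 < e /\ forall y, Rabs (y - x) < e -> g y <> 0.
Proof.
intros Hc Hx.
destruct (Hc (Rabs (g x)) (Rabs_pos_lt _ Hx)) as [e [He H]].
exists e. split; [exact He|]. intros y Hy E.
destruct (Req_dec x y) as [<-|Hne]; [contradiction|].
assert (H1 : Rabs (g y - g x) < Rabs (g x)).
{ apply (H y). split; [split; [exact I | exact Hne] | exact Hy]. }
rewrite E in H1. replace (0 - g x) with (- g x) in H1 by ring.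
rewrite Rabs_Ropp in H1. lra.
Qed.

(** Splitting off the first nonzero coefficient writes [f x] as [(x - x0)^k g (x - x0)] with [g]
    continuous and [g 0 <> 0]. *)
Lemma real_analytic_zero_dichotomy (f : R -> R) (x0 : R) :
  real_analytic f ->
  exists e, 0 < e /\
    ((forall x, Rabs (x - x0) < e -> f x = 0) \/
     (forall x, 0 < Rabs (x - x0) < e -> f x <> 0)).
Proof.
intros Hf. destruct (real_analytic_local f x0 Hf) as [r [a [Hr Ha]]].
assert (Hrad : Rbar_lt 0 (CV_radius a)).
{ destruct (Ha x0) as [H _]; replace (x0 - x0) with 0 in * by ring; rewrite Rabs_R0 in *;
  [exact Hr | exact H]. }
destruct (first_nonzero a) as [H0 | [k [Hk Hlt]]].
- exists r. split; [exact Hr|]. left. intros x Hx.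
  destruct (Ha x Hx) as [_ E]. rewrite E, <- (PSeries_const_0 (x - x0)).
  apply PSeries_ext. exact H0.
- set (g := PSeries (PS_decr_n a k)).
  assert (Hg : continuity_pt g 0).
  { apply PSeries_continuity. rewrite Rabs_R0.
    assert (E : CV_radius (PS_decr_n a k) = CV_radius a).
    { clear. induction k as [|k IH].
      - apply CV_radius_ext. intros n. reflexivity.
      - rewrite <- IH, <- (CV_radius_decr_1 (PS_decr_n a k)).
        apply CV_radius_ext. intros n. unfold PS_decr_n, PS_decr_1. f_equal. lia. }
    rewrite E. exact Hrad. }
  assert (Hg0 : g 0 <> 0).
  { unfold g. rewrite PSeries_0. unfold PS_decr_n. rewrite Nat.add_0_r. exact Hk. }
  destruct (continuity_pt_nonzero g 0 Hg Hg0) as [e [He Hne]].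
  exists (Rmin e r). split; [apply Rmin_pos; assumption|].
  right. intros x [Hx1 Hx2].
  destruct (Ha x) as [_ E]; [apply Rlt_le_trans with (1 := Hx2), Rmin_r|].
  rewrite E, (PSeries_decr_n_aux a k _ Hlt).
  apply Rmult_integral_contrapositive_currified.
  + apply pow_nonzero. intros E0. rewrite E0, Rabs_R0 in Hx1. lra.
  + apply Hne. rewrite Rminus_0_r. apply Rlt_le_trans with (1 := Hx2), Rmin_l.
Qed.

(** * Lifts of circle diffeomorphisms *)

(** If [P] failed somewhere, the supremum of the [x] with [P] true on [[a, x)] would be finite, and
    the hypothesis would push it further. This replaces connectedness and compactness arguments
    below. *)
Lemma real_induction (a : R) (P : R -> Prop) :
  (forall x, a <= x -> (forall y, a <= y < x -> P y) ->
    exists e, 0 < e /\ forall y, x <= y < x + e -> P y) ->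
  forall x, a <= x -> P x.
Proof.
intros H x1 Hx1. apply NNPP; intros Hn.
destruct (completeness (fun x => a <= x /\ forall y, a <= y < x -> P y)) as [m [Hub Hl]].
- exists x1. intros x [Hx Hy]. destruct (Rle_lt_dec x x1); [assumption|].
  exfalso. apply Hn, Hy. lra.
- exists a. split; [lra|]. intros y Hy; lra.
- assert (Ham : a <= m) by (apply Hub; split; [lra | intros; lra]).
  assert (Hm : forall y, a <= y < m -> P y).
  { intros y Hy. apply NNPP; intros Hny.
    assert (m <= y); [|lra]. apply Hl. intros x [Hx HP].
    destruct (Rle_lt_dec x y); [assumption|]. exfalso; apply Hny, HP; lra. }
  destruct (H m Ham Hm) as [e [He HP]].
  assert (m + e <= m); [|lra]. apply Hub. split; [lra|]. intros y Hy.
  destruct (Rlt_dec y m); [apply Hm; lra | apply HP; lra].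
Qed.

Lemma Nat_ceiling (x : R) : exists n : nat, x < INR n.
Proof.
destruct (Rle_lt_dec 0 x) as [H|H].
- destruct (INR_unbounded x) as [n Hn]. exists n; lra.
- exists O. simpl. lra.
Qed.

Lemma periodic_shift_nat (f : R -> R) (c : R) :
  (forall x, f (x + 1) = f x + c) -> forall n x, f (x + INR n) = f x + INR n * c.
Proof.
intros H. induction n as [|n IH]; intros x.
- simpl. rewrite Rplus_0_r. ring.
- rewrite S_INR. replace (x + (INR n + 1)) with ((x + INR n) + 1) by ring.
  rewrite H, IH. ring.
Qed.

Lemma periodic_shift (f : R -> R) (c : R) :
  (forall x, f (x + 1) = f x + c) -> forall k x, f (x + IZR k) = f x + IZR k * c.
Proof.
intros H k x. destruct (Z_le_gt_dec 0 k) as [Hk|Hk].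
- rewrite <- (Z2Nat.id k Hk), <- INR_IZR_INZ. apply periodic_shift_nat, H.
- assert (E := periodic_shift_nat f c H (Z.to_nat (- k)) (x + IZR k)).
  rewrite INR_IZR_INZ, Z2Nat.id, opp_IZR in E by lia.
  replace (x + IZR k + - IZR k) with x in E by ring. lra.
Qed.

Lemma frac_exists (x : R) : exists k, 0 <= x - IZR k < 1.
Proof.
exists (Int_part x). destruct (base_Int_part x). lra.
Qed.

(** Identity theorem: vanishing near [x0] spreads over the half-line to its right, and periodicity
    brings it back to [x1]. *)
Lemma analytic_periodic_zeros_isolated (f : R -> R) :
  real_analytic f -> (forall x, f (x + 1) = f x) -> (exists x, f x <> 0) ->
  forall x0, exists e, 0 < e /\ forall x, 0 < Rabs (x - x0) < e -> f x <> 0.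
Proof.
intros Hf Hp [x1 Hx1] x0.
destruct (real_analytic_zero_dichotomy f x0 Hf) as [e [He [H|H]]]; [|eauto].
exfalso.
assert (Hz : forall x, x0 <= x -> f x = 0).
{ apply real_induction. intros x Hx Hl.
  destruct (Req_dec x x0) as [->|Hne].
  - exists e. split; [exact He|]. intros y Hy. apply H. rewrite Rabs_pos_eq; lra.
  - destruct (real_analytic_zero_dichotomy f x Hf) as [d [Hd [H1|H1]]].
    + exists d. split; [exact Hd|]. intros y Hy. apply H1. rewrite Rabs_pos_eq; lra.
    + exfalso. set (y := Rmax x0 (x - d / 2)).
      assert (Hy : x0 <= y < x /\ x - d / 2 <= y).
      { unfold y. split; [split; [apply Rmax_l | apply Rmax_lub_lt; lra] | apply Rmax_r]. }
      apply (H1 y); [rewrite Rabs_left; lra | apply Hl; lra]. }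
destruct (Nat_ceiling (x0 - x1)) as [n Hn].
apply Hx1. rewrite <- (Hz (x1 + INR n)) by lra.
rewrite (periodic_shift_nat f 0); [ring | intros x; rewrite Hp; ring].
Qed.

(** Induction on the right end: within [e / 2] of [x] only [x] itself can be a zero, so one new
    entry extends the list past [x]. *)
Lemma isolated_zeros_finite (f : R -> R) (a b : R) :
  (forall x0, exists e, 0 < e /\ forall x, 0 < Rabs (x - x0) < e -> f x <> 0) ->
  exists L, forall x, a <= x <= b -> f x = 0 -> In x L.
Proof.
intros Hi. destruct (Rle_lt_dec a b) as [Hab|Hab].
2:{ exists nil. intros x Hx; lra. }
revert b Hab. apply real_induction. intros x Hx Hl.
destruct (Hi x) as [e [He H]].
assert (HL : exists L, forall z, a <= z <= x - e / 2 -> f z = 0 -> In z L).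
{ destruct (Rle_lt_dec a (x - e / 2)) as [H1|H1].
  - apply Hl. lra.
  - exists nil. intros z Hz. lra. }
destruct HL as [L HL]. exists (e / 2). split; [lra|]. intros y Hy.
exists (x :: L). intros z Hz Hfz.
destruct (Rle_lt_dec z (x - e / 2)) as [H1|H1]; [right; apply HL; [lra | exact Hfz]|].
left. destruct (Req_dec z x) as [E|E]; [auto|]. exfalso.
apply (H z); [|exact Hfz]. split.
- apply Rabs_pos_lt. lra.
- apply Rabs_def1; lra.
Qed.

Lemma MVT_Derive (f : R -> R) (x y : R) :
  (forall c, ex_derive f c) ->
  exists c, Rmin x y <= c <= Rmax x y /\ f y - f x = Derive f c * (y - x).
Proof.
intros H. apply (MVT_gen f x y (Derive f)).
- intros c _. apply Derive_correct, H.
- intros c _. apply derivable_continuous_pt. apply ex_derive_Reals_0, H.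
Qed.

Lemma ex_derive_continuity (f : R -> R) : (forall x, ex_derive f x) -> continuity f.
Proof. intros H x. apply derivable_continuous_pt. apply ex_derive_Reals_0, H. Qed.

Lemma periodic_min (g : R -> R) :
  continuity g -> (forall x, g (x + 1) = g x) -> exists m, forall x, g m <= g x.
Proof.
intros Hc Hp.
destruct (continuity_ab_min g 0 1) as [m [Hm _]]; [lra | intros; apply Hc|].
exists m. intros x. destruct (frac_exists x) as [k Hk].
replace (g x) with (g (x - IZR k)); [apply Hm; lra|].
replace x with (x - IZR k + IZR k) at 2 by ring.
rewrite (periodic_shift g 0); [ring | intros; rewrite Hp; ring].
Qed.

Lemma periodic_max (g : R -> R) :
  continuity g -> (forall x, g (x + 1) = g x) -> exists m, forall x, g x <= g m.
Proof.
intros Hc Hp.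
destruct (periodic_min (fun x => - g x)) as [m Hm].
- intros x. apply continuity_pt_opp, Hc.
- intros x. rewrite Hp; reflexivity.
- exists m. intros x. specialize (Hm x). lra.
Qed.

Lemma Derive_periodic (f : R -> R) (c : R) :
  (forall x, f (x + 1) = f x + c) -> forall x, Derive f (x + 1) = Derive f x.
Proof.
intros H x. unfold Derive. f_equal. apply Lim_ext. intros h.
replace (x + 1 + h) with (x + h + 1) by ring. rewrite !H. f_equal. ring.
Qed.

Local Notation lift := is_analytic_circle_diffeo_lift.

Lemma lift_ex_derive F : lift F -> forall x, ex_derive F x.
Proof. intros [H _]. apply real_analytic_derive, H. Qed.

Lemma lift_Derive_pos F : lift F -> forall x, 0 < Derive F x.
Proof.
intros [_ [_ H]] x. destruct (H x) as [d [H1 H2]].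
apply is_derive_Reals in H1. rewrite (is_derive_unique _ _ _ H1). exact H2.
Qed.

Lemma lift_incr F : lift F -> forall x y, x < y -> F x < F y.
Proof.
intros HF x y Hxy. destruct (MVT_Derive F x y (lift_ex_derive F HF)) as [c [_ E]].
assert (0 < Derive F c * (y - x)); [|lra].
apply Rmult_lt_0_compat; [apply lift_Derive_pos, HF | lra].
Qed.

Lemma lift_incr_le F : lift F -> forall x y, x <= y -> F x <= F y.
Proof.
intros HF x y [H| ->]; [left; apply lift_incr; assumption | right; reflexivity].
Qed.

Lemma lift_lt_inv F : lift F -> forall x y, F x < F y -> x < y.
Proof.
intros HF x y H. destruct (Rlt_le_dec x y) as [|Hn]; [assumption|].
apply (lift_incr_le F HF) in Hn. lra.
Qed.

Lemma lift_le_inv F : lift F -> forall x y, F x <= F y -> x <= y.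
Proof.
intros HF x y H. destruct (Rle_lt_dec x y) as [|Hn]; [assumption|].
apply (lift_incr F HF) in Hn. lra.
Qed.

Lemma lift_continuity F : lift F -> continuity F.
Proof. intros HF. apply ex_derive_continuity, lift_ex_derive, HF. Qed.

Lemma lift_shift F : lift F -> forall k x, F (x + IZR k) = F x + IZR k.
Proof.
intros [_ [H _]] k x. rewrite (periodic_shift F 1 H). ring.
Qed.

Lemma lift_Derive_periodic F : lift F -> forall x, Derive F (x + 1) = Derive F x.
Proof. intros [_ [H _]]. apply (Derive_periodic F 1 H). Qed.

Lemma lift_Derive_continuity F : lift F -> continuity (Derive F).
Proof.
intros [H _]. apply ex_derive_continuity. apply real_analytic_derive.
apply real_analytic_derive, H.
Qed.

Lemma lift_Derive_bounds F : lift F ->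
  exists m M, 0 < m /\ forall x, m <= Derive F x <= M.
Proof.
intros HF.
destruct (periodic_min (Derive F)) as [m Hm];
  [apply lift_Derive_continuity, HF | apply lift_Derive_periodic, HF|].
destruct (periodic_max (Derive F)) as [M HM];
  [apply lift_Derive_continuity, HF | apply lift_Derive_periodic, HF|].
exists (Derive F m), (Derive F M). split; [apply lift_Derive_pos, HF | auto].
Qed.

Lemma lift_lipschitz F : lift F ->
  exists M, 0 < M /\ forall x y, Rabs (F x - F y) <= M * Rabs (x - y).
Proof.
intros HF. destruct (lift_Derive_bounds F HF) as [m [M [Hm H]]].
exists M. split; [specialize (H 0); lra|].
intros x y. destruct (MVT_Derive F y x (lift_ex_derive F HF)) as [c [_ E]].
rewrite E, Rabs_mult. apply Rmult_le_compat_r; [apply Rabs_pos|].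
specialize (H c). rewrite Rabs_pos_eq; lra.
Qed.

(** The derivative of [ln F'] is [F'' / F'], continuous and periodic, hence bounded. All distortion
    estimates start from this constant. *)
Lemma lift_log_Derive_lipschitz F : lift F ->
  exists L, 0 < L /\
    forall x y, Rabs (ln (Derive F x) - ln (Derive F y)) <= L * Rabs (x - y).
Proof.
intros HF. assert (Ha : real_analytic F) by apply HF.
destruct (real_analytic_derive F Ha) as [_ Ha1].
destruct (real_analytic_derive _ Ha1) as [D2 Ha2].
destruct (real_analytic_derive _ Ha2) as [D3 _].
set (g := fun x => ln (Derive F x)).
assert (Hg : forall x, is_derive g x (Derive (Derive F) x / Derive F x)).
{ intros x. unfold g. auto_derive.
  - split; [apply D2 | split; [apply lift_Derive_pos, HF | exact I]].
  - rewrite Rmult_1_l. reflexivity. }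
assert (Hgc : continuity (Derive g)).
{ assert (E : forall x, Derive g x = Derive (Derive F) x / Derive F x)
    by (intros x; apply is_derive_unique, Hg).
  intros x. apply continuity_pt_ext with (f := fun x => Derive (Derive F) x / Derive F x);
    [intros; symmetry; apply E|].
  apply continuity_pt_div.
  - apply ex_derive_continuity. exact D3.
  - apply lift_Derive_continuity, HF.
  - assert (H := lift_Derive_pos F HF x). lra. }
assert (Hgp : forall x, Derive g (x + 1) = Derive g x).
{ apply (Derive_periodic g 0). intros x. unfold g.
  rewrite lift_Derive_periodic by exact HF. ring. }
destruct (periodic_min _ Hgc Hgp) as [m Hm].
destruct (periodic_max _ Hgc Hgp) as [M HM].
exists (Rabs (Derive g m) + Rabs (Derive g M) + 1). split.
{ assert (H1 := Rabs_pos (Derive g m)). assert (H2 := Rabs_pos (Derive g M)). lra. }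
intros x y.
destruct (MVT_Derive g y x) as [c [_ E]]; [intros c; eexists; apply Hg|].
fold (g x) (g y). rewrite E, Rabs_mult. apply Rmult_le_compat_r; [apply Rabs_pos|].
specialize (Hm c). specialize (HM c).
assert (H1 := Rabs_pos (Derive g m)). assert (H2 := Rabs_pos (Derive g M)).
apply Rabs_le. split.
- assert (H3 := Rcomplements.Rabs_maj2 (Derive g m)). lra.
- assert (H3 := Rle_abs (Derive g M)). lra.
Qed.

Lemma lift_fixed_isolated F : lift F -> (exists x, F x <> x) ->
  forall x0, exists e, 0 < e /\ forall x, 0 < Rabs (x - x0) < e -> F x <> x.
Proof.
intros HF [x1 Hx1] x0.
destruct (analytic_periodic_zeros_isolated (fun x => F x - x)) with (x0 := x0) as [e [He H]].
- apply real_analytic_sub_id, HF.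
- intros x. destruct HF as [_ [-> _]]. ring.
- exists x1. lra.
- exists e. split; [exact He|]. intros x Hx E. apply (H x Hx). lra.
Qed.

Lemma lift_fixed_finite F : lift F -> (exists x, F x <> x) ->
  exists L, forall x, F x = x -> exists l k, In l L /\ x = l + IZR k.
Proof.
intros HF Hn.
destruct (isolated_zeros_finite (fun x => F x - x) 0 1) as [L HL].
- intros x0. destruct (lift_fixed_isolated F HF Hn x0) as [e [He H]].
  exists e. split; [exact He|]. intros x Hx E. apply (H x Hx). lra.
- exists L. intros x Hx. destruct (frac_exists x) as [k Hk].
  exists (x - IZR k), k. split; [|ring]. apply HL; [lra|].
  unfold Rminus at 2. rewrite <- opp_IZR, lift_shift, Hx by exact HF.
  rewrite opp_IZR. ring.
Qed.

(** * Translation numbers *)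

Lemma group_lift G F : lift_subgroup G -> G F -> lift F.
Proof. intros [H _]. apply H. Qed.

Lemma group_comp G F H : lift_subgroup G -> G F -> G H -> G (fun x => F (H x)).
Proof. intros [_ [_ [HG _]]]. apply HG. Qed.

Lemma group_shift G F k : lift_subgroup G -> G F -> G (fun x => F x + IZR k).
Proof. intros [_ [_ [_ [_ HG]]]]. apply HG. Qed.

Lemma group_iter G F n : lift_subgroup G -> G F -> G (fun x => Nat.iter n F x).
Proof.
intros HG HF. induction n as [|n IH].
- exact (proj1 (proj2 HG)).
- exact (group_comp G F _ HG HF IH).
Qed.

Lemma group_inv G F : lift_subgroup G -> G F ->
  exists H, G H /\ (forall x, H (F x) = x) /\ (forall x, F (H x) = x).
Proof.
intros HG HF. destruct (proj1 (proj2 (proj2 (proj2 HG))) F HF) as [H [HH E]].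
exists H. split; [exact HH|]. split; [exact E|]. intros x.
assert (HL := group_lift G H HG HH).
apply Rle_antisym; apply (lift_le_inv H HL); rewrite E; lra.
Qed.

Lemma group_shift_mod G F k : lift_subgroup G -> G F ->
  forall x, F (x + IZR k) = F x + IZR k.
Proof. intros HG HF. apply lift_shift. exact (group_lift G F HG HF). Qed.

Lemma iter_gt (F : R -> R) (n : nat) (x : R) :
  (forall y, y < F y) -> (0 < n)%nat -> x < Nat.iter n F x.
Proof.
intros HF Hn. destruct n as [|n]; [lia|]. clear Hn. induction n as [|n IH]; simpl in *.
- apply HF.
- apply Rlt_trans with (1 := IH), HF.
Qed.

(** Translate [y] by an integer into [(x - 1, x]]; monotonicity squeezes [F x] between two
    consecutive integer translates of [F y]. *)
Lemma lift_displacement_variation F : lift F ->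
  forall x y, Rabs ((F x - x) - (F y - y)) <= 1.
Proof.
intros HF x y. destruct (frac_exists (x - y)) as [k Hk].
assert (H1 : F (y + IZR k) <= F x) by (apply lift_incr_le; [exact HF | lra]).
assert (H2 : F x <= F (y + IZR (k + 1)))
  by (apply lift_incr_le; [exact HF | rewrite plus_IZR; lra]).
rewrite lift_shift in H1, H2 by exact HF. rewrite plus_IZR in H2.
apply Rabs_le. lra.
Qed.

Lemma bounded_multiples_zero (a C : R) : (forall n, INR n * a <= C) -> a <= 0.
Proof.
intros H. destruct (Rle_lt_dec a 0) as [|Ha]; [assumption|]. exfalso.
destruct (Nat_ceiling (C / a)) as [n Hn]. specialize (H n).
apply (Rmult_lt_compat_r a) in Hn; [|exact Ha].
unfold Rdiv in Hn. rewrite Rmult_assoc, Rinv_l, Rmult_1_r in Hn by lra. lra.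
Qed.

(* [F^n 0] is additive in [n] up to an error 1, so [(F^n 0 - 1)/n <= (F^m 0 + 1)/m]
   for all [m, n] and the supremum of the left-hand sides is the translation number. *)
Lemma translation_number_quasi G F : lift_subgroup G -> G F ->
  exists t, forall n x, Rabs (Nat.iter n F x - x - INR n * t) <= 2.
Proof.
intros HG HF.
set (a := fun n => Nat.iter n F 0).
assert (Hl : forall n, lift (fun x => Nat.iter n F x))
  by (intros n; apply (group_lift G); [exact HG | apply group_iter; assumption]).
assert (Hd : forall n y, Rabs (Nat.iter n F y - y - a n) <= 1).
{ intros n y. assert (E := lift_displacement_variation _ (Hl n) y 0).
  unfold a. rewrite Rminus_0_r in E. exact E. }
assert (Hmul : forall m n, Rabs (a (m * n)%nat - INR m * a n) <= INR m).
{ induction m as [|m IH]; intros n.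
  - simpl. unfold a; simpl. rewrite Rmult_0_l, Rminus_0_r, Rabs_R0. lra.
  - simpl (S m * n)%nat. unfold a at 1. rewrite Nat.iter_add.
    assert (E := Hd n (a (m * n)%nat)). specialize (IH n).
    unfold a at 1 2 in E. fold (a n) in E.
    rewrite S_INR. unfold a at 1 in IH.
    apply Rabs_le_between in E. apply Rabs_le_between in IH.
    apply Rabs_le_between. lra. }
destruct (completeness (fun r => exists n, (0 < n)%nat /\ r = (a n - 1) / INR n)) as [t [Hub Hlub]].
- exists (a 1%nat + 1). intros r [n [Hn ->]].
  assert (Hp : 0 < INR n) by (apply lt_0_INR; exact Hn).
  apply (Rmult_le_reg_r (INR n)); [exact Hp|].
  unfold Rdiv. rewrite Rmult_assoc, Rinv_l, Rmult_1_r by lra.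
  assert (E := Hmul n 1%nat). rewrite Nat.mul_1_r in E.
  apply Rabs_le_between in E.
  assert (1 <= INR n) by (apply (le_INR 1); lia). lra.
- exists ((a 1%nat - 1) / INR 1), 1%nat. split; [lia | reflexivity].
- assert (Ht : forall n, Rabs (a n - INR n * t) <= 1).
  { intros n. destruct (Nat.eq_dec n 0) as [->|Hn].
    { unfold a; simpl. rewrite Rmult_0_l, Rminus_0_r, Rabs_R0. lra. }
    assert (Hp : 0 < INR n) by (apply lt_0_INR; lia).
    assert (H1 : (a n - 1) / INR n <= t) by (apply Hub; exists n; split; [lia | reflexivity]).
    assert (H2 : t <= (a n + 1) / INR n).
    { apply Hlub. intros r [m [Hm ->]].
      assert (Hq : 0 < INR m) by (apply lt_0_INR; exact Hm).
      assert (E1 := Hmul m n). assert (E2 := Hmul n m). rewrite Nat.mul_comm in E2.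
      apply Rabs_le_between in E1. apply Rabs_le_between in E2.
      apply (Rmult_le_reg_r (INR m * INR n)); [apply Rmult_lt_0_compat; assumption|].
      replace ((a m - 1) / INR m * (INR m * INR n)) with ((a m - 1) * INR n) by (field; lra).
      replace ((a n + 1) / INR n * (INR m * INR n)) with ((a n + 1) * INR m) by (field; lra).
      nra. }
    apply (Rmult_le_compat_r (INR n)) in H1; [|lra].
    apply (Rmult_le_compat_r (INR n)) in H2; [|lra].
    unfold Rdiv in H1, H2. rewrite Rmult_assoc, Rinv_l in H1, H2 by lra.
    apply Rabs_le_between. lra. }
  exists t. intros n x. specialize (Ht n). specialize (Hd n x).
  apply Rabs_le_between in Ht. apply Rabs_le_between in Hd.
  apply Rabs_le_between. lra.
Qed.

Lemma translation_number_of_quasi (F : R -> R) (t C : R) :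
  (forall n x, Rabs (Nat.iter n F x - x - INR n * t) <= C) -> translation_number F t.
Proof.
intros H x eps Heps.
destruct (Nat_ceiling (C / eps)) as [N HN]. exists N. intros n Hn.
assert (Hp : 0 < INR (S n)) by (apply lt_0_INR; lia).
unfold Rdist.
replace ((Nat.iter (S n) F x - x) / INR (S n) - t)
  with ((Nat.iter (S n) F x - x - INR (S n) * t) / INR (S n)) by (field; lra).
unfold Rdiv. rewrite Rabs_mult, (Rabs_pos_eq (/ INR (S n)))
  by (left; apply Rinv_0_lt_compat, Hp).
apply (Rmult_lt_reg_r (INR (S n))); [exact Hp|].
rewrite Rmult_assoc, Rinv_l, Rmult_1_r by lra.
apply Rle_lt_trans with (1 := H (S n) x).
assert (INR N <= INR (S n)) by (apply le_INR; lia).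
apply (Rmult_lt_compat_r eps) in HN; [|exact Heps].
unfold Rdiv in HN. rewrite Rmult_assoc, Rinv_l, Rmult_1_r in HN by lra.
nra.
Qed.

Lemma translation_number_bound G F t : lift_subgroup G -> G F ->
  translation_number F t ->
  forall n x, Rabs (Nat.iter n F x - x - INR n * t) <= 2.
Proof.
intros HG HF Ht. destruct (translation_number_quasi G F HG HF) as [t' H'].
assert (E : t = t') by (apply (UL_sequence _ t t' (Ht 0)
  (translation_number_of_quasi F t' 2 H' 0))).
rewrite E. exact H'.
Qed.

(** Each class [l + Z] has a least positive element: the fractional part of [l], or 1 when [l] is an
    integer. *)
Lemma positive_translates_bounded_below (L : list R) :
  exists mu, 0 < mu /\ forall l k, In l L -> 0 < l + IZR k -> mu <= l + IZR k.
Proof.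
induction L as [|l L [mu [Hmu IH]]].
- exists 1. split; [lra|]. intros l k [].
- assert (Hl : exists nu, 0 < nu /\ forall k, 0 < l + IZR k -> nu <= l + IZR k).
  { destruct (frac_exists l) as [j Hj].
    destruct (Req_dec (l - IZR j) 0) as [E|E].
    - exists 1. split; [lra|]. intros k Hk.
      replace l with (IZR j) in * by lra. rewrite <- plus_IZR in *.
      apply (IZR_le 1). apply lt_IZR in Hk. lia.
    - exists (l - IZR j). split; [lra|]. intros k Hk.
      assert (H : IZR (-1) < IZR (k + j)) by (rewrite plus_IZR; lra).
      apply lt_IZR in H. assert (H1 : IZR 0 <= IZR (k + j)) by (apply IZR_le; lia).
      rewrite plus_IZR in H1. lra. }
  destruct Hl as [nu [Hnu Hl]].
  exists (Rmin nu mu). split; [apply Rmin_pos; assumption|].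
  intros l' k [<-|Hin] Hk.
  + apply Rle_trans with (1 := Rmin_l _ _), Hl, Hk.
  + apply Rle_trans with (1 := Rmin_r _ _), IH; assumption.
Qed.

(* Positive translation numbers are bounded away from 0, and a lift without fixed
   points has nonzero translation number. *)
Lemma uniform_progress G : lift_subgroup G -> finite_rotation_image G ->
  exists M, forall F, G F -> (forall x, x < F x) -> forall x, x + 1 <= Nat.iter M F x.
Proof.
intros HG [L HL]. destruct (positive_translates_bounded_below L) as [mu [Hmu Hgap]].
(* [M mu > 3] leaves a gain of 1 after the error 2 of [translation_number_quasi]. *)
destruct (Nat_ceiling (3 / mu)) as [M HM]. exists M. intros F HF Hpos x.
assert (HFl := group_lift G F HG HF).
destruct (translation_number_quasi G F HG HF) as [t Ht].
assert (Htr := translation_number_of_quasi F t 2 Ht).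
assert (Htpos : 0 < t).
(* The displacement attains a positive minimum [c], so [F^n 0 >= n c] and the translation number is
   at least [c]. *)
{ destruct (periodic_min (fun x => F x - x)) as [m Hm].
  - intros y. apply continuity_pt_minus; [apply lift_continuity, HFl|].
    apply derivable_continuous_pt, derivable_pt_id.
  - intros y. rewrite (lift_shift F HFl 1). ring.
  - assert (Hc := Hpos m). set (c := F m - m) in *.
    assert (Hit : forall n, INR n * c <= Nat.iter n F 0).
    { induction n as [|n IH]; [simpl; lra|].
      rewrite S_INR. simpl. specialize (Hm (Nat.iter n F 0)). lra. }
    assert (c - t <= 0); [|unfold c in *; lra].
    apply bounded_multiples_zero with 2. intros n.
    specialize (Hit n). specialize (Ht n 0). apply Rabs_le_between in Ht. lra. }
destruct (HL F t HF Htr) as [l [k [Hl E]]].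
assert (Hmt : mu <= t) by (rewrite E; apply Hgap; [exact Hl | lra]).
specialize (Ht M x). apply Rabs_le_between in Ht.
apply (Rmult_lt_compat_r mu) in HM; [|exact Hmu].
unfold Rdiv in HM. rewrite Rmult_assoc, Rinv_l, Rmult_1_r in HM by lra.
assert (INR M * mu <= INR M * t) by (apply Rmult_le_compat_l; [apply pos_INR | exact Hmt]).
lra.
Qed.

(** * Finite orbits give finitely many rotation numbers *)

Lemma choice_list (Q : nat -> R -> Prop) (n : nat) :
  (forall i, (i < n)%nat -> exists r, Q i r) ->
  exists l, length l = n /\ forall i, (i < n)%nat -> Q i (nth i l 0).
Proof.
induction n as [|n IH]; intros H.
- exists nil. split; [reflexivity | intros; lia].
- destruct IH as [l [Hl HQ]]; [intros; apply H; lia|].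
  destruct (H n) as [r Hr]; [lia|].
  exists (l ++ r :: nil). split; [rewrite length_app; simpl; lia|].
  intros i Hi. destruct (Nat.eq_dec i n) as [->|Hne].
  + rewrite app_nth2, Hl, Nat.sub_diag by lia. exact Hr.
  + rewrite app_nth1 by lia. apply HQ. lia.
Qed.

(** The bound [j <= length L] in the conclusion is what limits the denominators of the rotation
    numbers. *)
Lemma pigeonhole (Q : nat -> R -> Prop) (L : list R) :
  (forall i, (i <= length L)%nat -> exists r, In r L /\ Q i r) ->
  exists i j r, (i < j <= length L)%nat /\ Q i r /\ Q j r.
Proof.
intros H.
destruct (choice_list (fun i r => In r L /\ Q i r) (S (length L))) as [l [Hl HQ]];
  [intros i Hi; apply H; lia|].
apply NNPP; intros Hn.
assert (Hnd : NoDup l).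
{ apply (proj2 (NoDup_nth l 0)). intros i j Hi Hj E. rewrite Hl in Hi, Hj.
  destruct (HQ i Hi) as [_ Qi]. destruct (HQ j Hj) as [_ Qj].
  destruct (Nat.lt_trichotomy i j) as [Hij|[Hij|Hij]]; [|exact Hij|]; exfalso; apply Hn.
  - exists i, j, (nth i l 0). rewrite E at 2. repeat split; [lia | lia | exact Qi | exact Qj].
  - exists j, i, (nth j l 0). rewrite <- E at 2. repeat split; [lia | lia | exact Qj | exact Qi]. }
assert (Hinc : incl l L).
{ intros r Hr. destruct (In_nth l r 0 Hr) as [i [Hi <-]]. apply HQ. lia. }
assert (Hlen := NoDup_incl_length Hnd Hinc). lia.
Qed.

(** Two early points of an [F]-orbit agree mod [Z], so [F^d y = y + p] with [d <= length L]. Hence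
    the translation number is [p / d], one of finitely many fractions up to integers. *)
Lemma finite_orbit_finite_rotation_image G :
  lift_subgroup G -> has_finite_orbit G -> finite_rotation_image G.
Proof.
intros HG [x [L HL]].
exists (flat_map (fun j => map (fun p => INR p / INR j) (seq 0 j)) (seq 1 (length L))).
intros F t HF Ht.
destruct (pigeonhole (fun i r => exists k, Nat.iter i F x = r + IZR k) L)
  as [i [j [r [Hij [[k Hk] [k' Hk']]]]]].
{ intros i _. destruct (HL _ (group_iter G F i HG HF)) as [l [k [Hl E]]].
  exists l. split; [exact Hl|]. exists k. exact E. }
set (y := Nat.iter i F x) in *. set (d := (j - i)%nat). set (p := (k' - k)%Z).
assert (Hd : (1 <= d <= length L)%nat) by (unfold d; lia).
assert (Hp : Nat.iter d F y = y + IZR p).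
{ unfold y at 1. rewrite <- Nat.iter_add. replace (d + i)%nat with j by (unfold d; lia).
  unfold p. rewrite minus_IZR. lra. }
assert (Hmul : forall m, Nat.iter (m * d) F y = y + INR m * IZR p).
{ induction m as [|m IH]; [simpl; ring|].
  simpl (S m * d)%nat. rewrite Nat.iter_add, IH.
  rewrite S_INR, INR_IZR_INZ, <- mult_IZR.
  rewrite (group_shift_mod G (fun x => Nat.iter d F x)) by (try apply group_iter; assumption).
  rewrite Hp, mult_IZR. ring. }
assert (Hdp : 0 < INR d) by (apply lt_0_INR; lia).
(* [F^(m d) y - y] equals [m p] and is within 2 of [m d t] for every [m]. *)
assert (Ept : IZR p = INR d * t).
{ apply Rle_antisym; apply Rminus_le; apply bounded_multiples_zero with 2; intros m;
  assert (E := translation_number_bound G F t HG HF Ht (m * d) y);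
  rewrite Hmul, mult_INR in E; apply Rabs_le_between in E; lra. }
assert (Hdz : (0 < Z.of_nat d)%Z) by lia.
assert (Em := Z.div_mod p (Z.of_nat d) ltac:(lia)).
assert (Hm := Z.mod_pos_bound p (Z.of_nat d) Hdz).
set (q := (p / Z.of_nat d)%Z) in *. set (s := (p mod Z.of_nat d)%Z) in *.
exists (INR (Z.to_nat s) / INR d), q. split.
- apply in_flat_map. exists d. split; [apply in_seq; lia|].
  apply (in_map (fun p0 => INR p0 / INR d)). apply in_seq. lia.
- rewrite (INR_IZR_INZ (Z.to_nat s)), Z2Nat.id by lia.
  apply (f_equal IZR) in Em. rewrite plus_IZR, mult_IZR, <- INR_IZR_INZ in Em.
  apply (Rmult_eq_reg_l (INR d)); [|lra]. rewrite <- Ept, Em. field. lra.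
Qed.

(** * Elements close to the identity *)

Definition near_id (eps : R) (F : R -> R) : Prop :=
  forall x, Rabs (F x - x) < eps /\ Rabs (Derive F x - 1) < eps.

Lemma Derive_lift_comp F H : lift F -> lift H ->
  forall x, Derive (fun y => F (H y)) x = Derive F (H x) * Derive H x.
Proof.
intros HF HH x. rewrite Derive_comp; [ring | apply lift_ex_derive, HF | apply lift_ex_derive, HH].
Qed.

(** The derivative of [H] is the inverse of a number at least [1 / 2], and inversion there at most
    doubles the distance to 1. *)
Lemma near_id_inverse F H eps : lift F -> lift H -> (forall x, F (H x) = x) ->
  eps <= 1 / 2 -> near_id eps F -> near_id (2 * eps) H.
Proof.
intros HF HH E Heps Hn x. destruct (Hn (H x)) as [H1 H2].
rewrite E in H1. apply Rabs_def2 in H1. apply Rabs_def2 in H2.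
split; [apply Rabs_def1; lra|].
assert (E' : Derive F (H x) * Derive H x = 1).
{ rewrite <- Derive_lift_comp by assumption.
  rewrite (Derive_ext (fun y => F (H y)) (fun y => y)) by exact E. apply Derive_id. }
assert (Hp := lift_Derive_pos H HH x).
apply Rabs_def1; nra.
Qed.

(** The inverse is kept alongside, so that the direction in which a given point moves can be
    chosen. *)
Lemma near_identity_pair G : lift_subgroup G -> C1_nondiscrete G ->
  forall eps, 0 < eps -> exists F H, G F /\ G H /\
    (forall x, H (F x) = x) /\ (forall x, F (H x) = x) /\
    (exists x, F x <> x) /\ near_id eps F /\ near_id eps H.
Proof.
intros HG [Fs [HFs Hlim]] eps Heps.
set (d := Rmin (eps / 2) (1 / 2)).
assert (Hd : 0 < d) by (apply Rmin_pos; lra).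
assert (Hd1 : d <= eps / 2) by apply Rmin_l.
assert (Hd2 : d <= 1 / 2) by apply Rmin_r.
destruct (Hlim d Hd) as [N HN]. destruct (HFs N) as [HGF Hni].
set (F := Fs N) in *. assert (HF := group_lift G F HG HGF).
destruct (group_inv G F HG HGF) as [H [HGH [E1 E2]]].
assert (Hn : near_id d F).
{ intros x. destruct (HN N (le_n N) x) as [H1 H2]. split; [exact H1|]. apply H2.
  apply is_derive_Reals, Derive_correct, lift_ex_derive, HF. }
assert (Hn' := near_id_inverse F H d HF (group_lift G H HG HGH) E2 Hd2 Hn).
exists F, H. repeat split; try assumption.
- apply NNPP; intros Hno. apply Hni. exists 0%Z. intros x.
  destruct (Req_dec (F x) x) as [E|E]; [rewrite E; ring | exfalso; eauto].
- apply Rlt_le_trans with (1 := proj1 (Hn x)). lra.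
- apply Rlt_le_trans with (1 := proj2 (Hn x)). lra.
- apply Rlt_le_trans with (1 := proj1 (Hn' x)). lra.
- apply Rlt_le_trans with (1 := proj2 (Hn' x)). lra.
Qed.

Lemma fixed_point_between (f : R -> R) (a b : R) : continuity f -> a <= b ->
  (f a - a) * (f b - b) <= 0 -> exists c, a <= c <= b /\ f c = c.
Proof.
intros Hf Hab Hs.
destruct (IVT_cor (fun x => f x - x) a b) as [c [Hc E]].
- intros x. apply continuity_pt_minus; [apply Hf | apply derivable_continuous_pt, derivable_pt_id].
- exact Hab.
- exact Hs.
- exists c. split; [exact Hc | lra].
Qed.

Lemma fixed_or_one_sided (f : R -> R) : continuity f ->
  (exists x, f x = x) \/ (forall x, x < f x) \/ (forall x, f x < x).
Proof.
intros Hf. destruct (classic (exists x, f x = x)) as [|Hn]; [left; assumption|]. right.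
assert (Hcases : forall x, f x < x \/ x < f x).
{ intros x. destruct (Rtotal_order (f x) x) as [|[|]]; [left; assumption | | right; lra].
  exfalso; eauto. }
destruct (Hcases 0) as [H0|H0]; [right | left]; intros x; destruct (Hcases x) as [Hx|Hx];
  try exact Hx; exfalso; apply Hn;
  (destruct (Rle_lt_dec 0 x) as [Hx0|Hx0];
   [destruct (fixed_point_between f 0 x Hf Hx0) as [c [_ Hc]]
   |destruct (fixed_point_between f x 0 Hf) as [c [_ Hc]]]); try (exists c; exact Hc); nra.
Qed.

Lemma iter_lt_linear (F : R -> R) (c : R) (n : nat) (x : R) :
  (forall y, F y <= y + c) -> Nat.iter n F x <= x + INR n * c.
Proof.
intros H. induction n as [|n IH]; [simpl; lra|].
rewrite S_INR. simpl. specialize (H (Nat.iter n F x)). lra.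
Qed.

(** Without fixed points, an element of displacement below [1 / (M + 1)], or its inverse, would
    advance by less than 1 in [M] steps, against [uniform_progress]. *)
Lemma near_identity_fixed_point G : lift_subgroup G -> finite_rotation_image G ->
  exists eps, 0 < eps /\ forall F, G F -> near_id eps F -> exists x, F x = x.
Proof.
intros HG HR. destruct (uniform_progress G HG HR) as [M HM].
assert (Hp : 0 < INR M + 1) by (assert (H := pos_INR M); lra).
assert (Hsmall : INR M * / (INR M + 1) < 1).
{ apply (Rmult_lt_reg_r (INR M + 1)); [exact Hp|].
  rewrite Rmult_assoc, Rinv_l by lra. lra. }
exists (/ (INR M + 1)). split; [apply Rinv_0_lt_compat, Hp|].
intros F HF Hn.
destruct (fixed_or_one_sided F) as [|[Hc|Hc]];
  [apply lift_continuity, (group_lift G); assumption | assumption | exfalso | exfalso].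
- assert (H1 := HM F HF Hc 0).
  assert (H2 := iter_lt_linear F (/ (INR M + 1)) M 0).
  assert (H3 : Nat.iter M F 0 <= 0 + INR M * / (INR M + 1)).
  { apply H2. intros y. destruct (Hn y) as [H _]. apply Rabs_def2 in H. lra. }
  lra.
- destruct (group_inv G F HG HF) as [H [HH [E1 E2]]].
  assert (H1 : forall x, x < H x) by (intros x; specialize (Hc (H x)); rewrite E2 in Hc; exact Hc).
  specialize (HM H HH H1 0).
  assert (H3 : Nat.iter M H 0 <= 0 + INR M * / (INR M + 1)).
  { apply iter_lt_linear. intros y. destruct (Hn (H y)) as [H4 _].
    rewrite E2 in H4. apply Rabs_def2 in H4. lra. }
  lra.
Qed.

(** * Contractions near a fixed point *)

(** A closed invariant subset of the circle is encoded by its preimage in [R]; for a [lift_subgroup]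
    the integer translations belong to [G], which makes such a set periodic. *)
Definition closed_invariant (G : (R -> R) -> Prop) (B : R -> Prop) : Prop :=
  (forall F x, G F -> B x -> B (F x)) /\
  (forall x, (forall e, 0 < e -> exists y, B y /\ Rabs (y - x) < e) -> B x).

Lemma closed_invariant_shift G B k x : lift_subgroup G -> closed_invariant G B ->
  B x -> B (x + IZR k).
Proof.
intros HG [HB _] Hx.
exact (HB _ x (group_shift G (fun y => y) k HG (proj1 (proj2 HG))) Hx).
Qed.

Lemma nonfixed_open (f : R -> R) (y : R) : continuity f -> f y <> y ->
  exists d, 0 < d /\ forall x, Rabs (x - y) < d -> f x <> x.
Proof.
intros Hf Hy.
destruct (continuity_pt_nonzero (fun x => f x - x) y) as [d [Hd H]].
- apply continuity_pt_minus; [apply Hf | apply derivable_continuous_pt, derivable_pt_id].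
- lra.
- exists d. split; [exact Hd|]. intros x Hx E. apply (H x Hx). lra.
Qed.

Lemma iter_between (g : R -> R) (e z : R) (k : nat) :
  (forall x y, x < y -> g x < g y) -> g e = e -> (forall y, e < y <= z -> g y < y) -> e < z ->
  e < Nat.iter k g z <= z.
Proof.
intros Hm He Hg Hz. induction k as [|k IH]; [simpl; lra|]. simpl.
assert (H1 := Hg _ IH). assert (H2 := Hm e _ (proj1 IH)). lra.
Qed.

(** On [[e + eta, z]] the displacement [y - g y] has a positive minimum, so the decreasing orbit of
    [z] cannot stay there. *)
Lemma iter_tends_to_fixed (g : R -> R) (e z : R) :
  continuity g -> (forall x y, x < y -> g x < g y) -> g e = e ->
  (forall y, e < y <= z -> g y < y) -> e < z ->
  forall eta, 0 < eta -> exists K, forall k, (K <= k)%nat -> e < Nat.iter k g z < e + eta.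
Proof.
intros Hc Hm He Hg Hz eta Heta.
assert (Hb := fun k => iter_between g e z k Hm He Hg Hz).
assert (HK : exists K, Nat.iter K g z < e + eta).
{ apply NNPP; intros Hn.
  assert (Hge : forall k, e + eta <= Nat.iter k g z).
  { intros k. destruct (Rle_lt_dec (e + eta) (Nat.iter k g z)); [assumption|].
    exfalso; eauto. }
  assert (Hle : e + eta <= z) by (apply (Hge 0%nat)).
  destruct (continuity_ab_min (fun y => y - g y) (e + eta) z Hle) as [m [Hmin Hm']].
  { intros c _. apply continuity_pt_minus; [apply derivable_continuous_pt, derivable_pt_id | apply Hc]. }
  assert (Hcp : 0 < m - g m) by (assert (H := Hg m); lra).
  assert (Hit : forall k, Nat.iter k g z <= z - INR k * (m - g m)).
  { induction k as [|k IH]; [simpl; lra|]. rewrite S_INR. simpl.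
    assert (H := Hmin (Nat.iter k g z) (conj (Hge k) (proj2 (Hb k)))). lra. }
  assert (m - g m <= 0); [|lra].
  apply bounded_multiples_zero with (z - e). intros n.
  specialize (Hit n). specialize (Hb n). lra. }
destruct HK as [K HK]. exists K. intros k Hk. split; [apply Hb|].
induction Hk as [|k Hk IH]; [exact HK|]. simpl.
assert (H := Hg _ (Hb k)). lra.
Qed.

(** By the intermediate value theorem [f y - y] has constant sign on [(e, z]]; [g] is [f] or its
    inverse accordingly. *)
Lemma contracting_orientation G f e z : lift_subgroup G -> G f -> f e = e -> e < z ->
  (forall y, e < y <= z -> f y <> y) ->
  exists g, G g /\ g e = e /\ (forall y, e < y <= z -> g y < y).
Proof.
intros HG Hf He Hz Hn.
assert (side : forall g, G g -> (forall y, e < y <= z -> g y <> y) -> g z < z ->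
   forall y, e < y <= z -> g y < y).
{ intros g Hg Hgn Hgz y Hy. destruct (Rtotal_order (g y) y) as [H|[H|H]];
    [exact H | exfalso; apply (Hgn y Hy H) |].
  exfalso. destruct (fixed_point_between g y z) as [c [Hc E]].
  - apply lift_continuity, (group_lift G); assumption.
  - lra.
  - nra.
  - apply (Hgn c); [lra | exact E]. }
destruct (Rtotal_order (f z) z) as [H|[H|H]].
- exists f. auto.
- exfalso. apply (Hn z); [lra | exact H].
- destruct (group_inv G f HG Hf) as [g [Hg [E1 E2]]].
  exists g. split; [exact Hg|]. split; [rewrite <- He at 1; apply E1|].
  apply side; [exact Hg | |].
  + intros y Hy E. apply (Hn y Hy). rewrite <- E at 1. apply E2.
  + apply (lift_lt_inv f); [apply (group_lift G); assumption|]. rewrite E2. exact H.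
Qed.

(** Induction on the list. If some [x] in the tail has no successor in the tail, it leads to [a];
    then [a] leads to itself, since by transitivity any other successor of [a] would be one of
    [x]. *)
Lemma finite_transitive_loop {A : Type} (P : A -> Prop) (Q : A -> A -> Prop) :
  (forall x y z, P x -> P y -> P z -> Q x y -> Q y z -> Q x z) ->
  forall L, (exists x, In x L /\ P x) ->
  (forall x, In x L -> P x -> exists y, In y L /\ P y /\ Q x y) ->
  exists x, P x /\ Q x x.
Proof.
intros Ht. induction L as [|a L IH]; [intros [x [[] _]]|].
intros Hex Hs.
destruct (classic (exists x, In x L /\ P x)) as [HL|HL].
- destruct (classic (forall x, In x L -> P x -> exists y, In y L /\ P y /\ Q x y)) as [H|H];
    [apply IH; assumption|].
  apply not_all_ex_not in H. destruct H as [x H].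
  apply imply_to_and in H. destruct H as [Hx H].
  apply imply_to_and in H. destruct H as [HPx H].
  destruct (Hs x (or_intror Hx) HPx) as [y [[<-|Hy] [HPa Hxa]]];
    [|exfalso; apply H; eauto].
  destruct (Hs a (or_introl eq_refl) HPa) as [z [[<-|Hz] [HPz Haz]]].
  + exists a. auto.
  + exfalso. apply H. exists z. eauto.
- destruct Hex as [x [[<-|Hx] HPx]]; [|exfalso; eauto].
  destruct (Hs a (or_introl eq_refl) HPx) as [y [[<-|Hy] [HPy Hxy]]];
    [exists a; auto | exfalso; eauto].
Qed.

Lemma last_fixed_point (f : R -> R) (x y : R) : continuity f -> f x = x -> x <= y -> f y <> y ->
  exists e, f e = e /\ e < y /\ forall z, e < z <= y -> f z <> z.
Proof.
intros Hf Hx Hxy Hy.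
destruct (completeness (fun z => z <= y /\ f z = z)) as [e [Hub Hlub]].
- exists y. intros z [Hz _]. exact Hz.
- exists x. auto.
- assert (Hey : e <= y) by (apply Hlub; intros z [Hz _]; exact Hz).
  assert (He : f e = e).
  { apply NNPP; intros Hn. destruct (nonfixed_open f e Hf Hn) as [d [Hd H]].
    assert (e <= e - d); [|lra]. apply Hlub. intros z [Hz E].
    destruct (Rle_lt_dec z (e - d)) as [|Hc]; [assumption|]. exfalso.
    assert (z <= e) by (apply Hub; auto).
    apply (H z); [apply Rabs_def1; lra | exact E]. }
  exists e. split; [exact He|]. split.
  + destruct Hey as [|E]; [assumption|]. subst. contradiction.
  + intros z Hz E. assert (z <= e); [apply Hub; split; [lra | exact E] | lra].
Qed.

(* Write [e -> e'] if some image of [e] lies in the complementary interval of [Fix f]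
   whose left end is [e'].  Iterating [f] or its inverse brings that image to [e'], so
   the relation is transitive; it is total as orbits are infinite, and [Fix f] is finite
   mod [Z], so it has a loop. *)
Lemma fixed_point_returning_beside_itself G B f :
  lift_subgroup G -> ~ has_finite_orbit G -> closed_invariant G B ->
  G f -> (exists x, f x <> x) -> (exists e, B e /\ f e = e) ->
  exists e h, B e /\ f e = e /\ G h /\ e < h e /\ forall y, e < y <= h e -> f y <> y.
Proof.
intros HG Hno HB Hf Hnt [e0 [HBe0 Hfe0]].
assert (Hfl := group_lift G f HG Hf). assert (Hfc := lift_continuity f Hfl).
destruct (lift_fixed_finite f Hfl Hnt) as [L HL].
set (P := fun e => B e /\ f e = e).
set (Q := fun e e' => exists h, G h /\ e' < h e /\ forall y, e' < y <= h e -> f y <> y).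
assert (Hrep : forall e, P e -> exists l k, In l L /\ P l /\ e = l + IZR k).
{ intros e [HBe Hfe]. destruct (HL e Hfe) as [l [k [Hl E]]].
  exists l, k. split; [exact Hl|]. split; [|exact E].
  assert (El : l = e + IZR (- k)) by (rewrite opp_IZR; lra).
  split.
  - rewrite El. apply (closed_invariant_shift G); assumption.
  - rewrite El, lift_shift, Hfe by exact Hfl. reflexivity. }
assert (Hloop : exists e, P e /\ Q e e).
{ apply (finite_transitive_loop P Q) with L.
  - intros e e' e'' [HBe Hfe] [HBe' Hfe'] [HBe'' Hfe''] [h [Hh [Hlt Hnf]]] [h' [Hh' [Hlt' Hnf']]].
    destruct (contracting_orientation G f e' (h e) HG Hf Hfe' Hlt Hnf) as [g [Hg [Hge Hgy]]].
    assert (Hgl := group_lift G g HG Hg).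
    assert (Hh'l := group_lift G h' HG Hh').
    destruct (nonfixed_open f (h' e') Hfc) as [d [Hd Hnd]]; [apply Hnf'; lra|].
    destruct (lift_lipschitz h' Hh'l) as [M [HM HLip]].
    (* [M] is a Lipschitz constant of [h'], so [h' g^K h] brings [e] within [d] of [h' e'], where
       [f] has no fixed points. *)
    destruct (iter_tends_to_fixed g e' (h e) (lift_continuity g Hgl) (lift_incr g Hgl) Hge Hgy Hlt
      (d / M)) as [K HK]; [apply Rdiv_lt_0_compat; assumption|].
    specialize (HK K (le_n K)).
    exists (fun x => h' (Nat.iter K g (h x))).
    split; [apply (group_comp G h' (fun x => Nat.iter K g (h x)) HG Hh');
            apply (group_comp G (fun x => Nat.iter K g x) h HG); [apply group_iter|]; assumption|].
    set (w := Nat.iter K g (h e)) in *.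
    assert (H1 : h' e' < h' w) by (apply lift_incr; [exact Hh'l | lra]).
    assert (H2 : h' w - h' e' < d).
    { specialize (HLip w e'). rewrite !Rabs_pos_eq in HLip by lra.
      apply Rle_lt_trans with (1 := HLip).
      replace d with (M * (d / M)) by (field; lra).
      apply Rmult_lt_compat_l; lra. }
    split; [lra|]. intros y Hy.
    destruct (Rle_lt_dec y (h' e')) as [Hc|Hc]; [apply Hnf'; lra|].
    apply Hnd. apply Rabs_def1; lra.
  - destruct (Hrep e0 (conj HBe0 Hfe0)) as [l [k [Hl [HPl _]]]]. eauto.
  - intros e _ [HBe Hfe].
    (* Otherwise the orbit of [e] would lie in the fixed set of [f], which is finite mod [Z]. *)
    assert (Hh : exists h, G h /\ f (h e) <> h e).
    { apply NNPP; intros Hn. apply Hno. exists e, L. intros h Hh.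
      apply HL. apply NNPP; intros Hne. apply Hn. eauto. }
    destruct Hh as [h [Hh Hne]].
    destruct (frac_exists (h e - e)) as [k Hk].
    destruct (last_fixed_point f (e + IZR k) (h e) Hfc) as [e' [Hfe' [Hlt Hnf]]];
      [rewrite lift_shift, Hfe by exact Hfl; reflexivity | lra | exact Hne|].
    destruct (contracting_orientation G f e' (h e) HG Hf Hfe' Hlt Hnf) as [g [Hg [Hge Hgy]]].
    assert (Hgl := group_lift G g HG Hg).
    (* [e'] is a limit of the points [g^K (h e)] of the closed set [B]. *)
    assert (HBe' : B e').
    { apply (proj2 HB). intros d Hd.
      destruct (iter_tends_to_fixed g e' (h e) (lift_continuity g Hgl) (lift_incr g Hgl) Hge Hgy Hlt
        d Hd) as [K HK]. specialize (HK K (le_n K)).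
      exists (Nat.iter K g (h e)). split; [|apply Rabs_def1; lra].
      apply (proj1 HB (fun x => Nat.iter K g x)); [apply group_iter; assumption|].
      apply (proj1 HB); assumption. }
    destruct (Hrep e' (conj HBe' Hfe')) as [l [j [Hl [HPl E]]]].
    exists l. split; [exact Hl|]. split; [exact HPl|].
    exists (fun x => h x + IZR (- j)). split; [apply group_shift; assumption|].
    rewrite opp_IZR. split; [lra|]. intros y Hy E'.
    apply (Hnf (y + IZR j)); [lra|]. rewrite lift_shift, E' by exact Hfl. reflexivity. }
destruct Hloop as [e [[HBe Hfe] [h [Hh [Hlt Hnf]]]]].
exists e, h. auto.
Qed.

(** * Bounded distortion of iterates *)

Lemma Derive_iter_succ g k x : lift g -> lift (fun y => Nat.iter k g y) ->
  Derive (fun y => Nat.iter (S k) g y) x =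
  Derive g (Nat.iter k g x) * Derive (fun y => Nat.iter k g y) x.
Proof. intros Hg Hk. exact (Derive_lift_comp g (fun y => Nat.iter k g y) Hg Hk x). Qed.

Lemma Rabs_diff_interval (a b x y : R) : a <= x <= b -> a <= y <= b -> Rabs (x - y) <= b - a.
Proof. intros. apply Rabs_le. lra. Qed.

Lemma ratio_of_log (a b c : R) : 0 < a -> 0 < b -> Rabs (ln a - ln b) <= c -> a <= exp c * b.
Proof.
intros Ha Hb H. apply Rabs_le_between in H.
rewrite <- (exp_ln a Ha), <- (exp_ln b Hb), <- exp_plus at 1.
destruct (Rle_lt_or_eq_dec (ln a) (c + ln b)) as [H1|H1]; [lra | left | right].
- apply exp_increasing. exact H1.
- rewrite <- H1. reflexivity.
Qed.

(* The intervals [g^i [s, t]] do not overlap because [g t <= s], so the distortion of the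
   iterates on [[s, t]] telescopes. *)
Lemma iter_distortion g L s t : (forall n, lift (fun y => Nat.iter n g y)) ->
  (forall x y, Rabs (ln (Derive g x) - ln (Derive g y)) <= L * Rabs (x - y)) ->
  0 < L -> g t <= s -> forall k x y, s <= x <= t -> s <= y <= t ->
  Rabs (ln (Derive (fun y => Nat.iter k g y) x) - ln (Derive (fun y => Nat.iter k g y) y))
    <= L * (t - Nat.iter k g t).
Proof.
intros Hl HL HLp Hgt k x y Hx Hy.
assert (Hg : lift g) by exact (Hl 1%nat).
induction k as [|k IH].
- simpl. rewrite !Derive_id. rewrite !Rminus_diag, Rabs_R0. lra.
- rewrite !Derive_iter_succ by (try apply Hl; exact Hg).
  rewrite !ln_mult by (try apply lift_Derive_pos; try apply Hl; exact Hg).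
  match goal with |- Rabs (?a + ?b - (?c + ?d)) <= _ =>
    replace (a + b - (c + d)) with ((a - c) + (b - d)) by ring end.
  apply Rle_trans with (1 := Rabs_triang _ _).
  specialize (HL (Nat.iter k g x) (Nat.iter k g y)).
  assert (H1 : Rabs (Nat.iter k g x - Nat.iter k g y) <= Nat.iter k g t - Nat.iter k g s).
  { apply Rabs_diff_interval; split; apply (lift_incr_le _ (Hl k)); lra. }
  assert (H2 : Nat.iter (S k) g t <= Nat.iter k g s).
  { rewrite Nat.iter_succ_r. apply (lift_incr_le _ (Hl k)). exact Hgt. }
  assert (H3 : L * Rabs (Nat.iter k g x - Nat.iter k g y)
     <= L * (Nat.iter k g t - Nat.iter (S k) g t)) by (apply Rmult_le_compat_l; lra).
  lra.
Qed.

(** The mean value theorem gives a point of [[s, t]] where the derivative is the length ratio of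
    [g^k [s, t]] to [[s, t]]; distortion carries this to every other point at the cost of
    [exp L]. *)
Lemma iter_Derive_bound g L e s t : (forall n, lift (fun y => Nat.iter n g y)) ->
  (forall x y, Rabs (ln (Derive g x) - ln (Derive g y)) <= L * Rabs (x - y)) ->
  0 < L -> g t <= s -> s < t -> (forall k, e < Nat.iter k g t) ->
  (forall k, e < Nat.iter k g s) -> t - e <= 1 -> forall k x, s <= x <= t ->
  Derive (fun y => Nat.iter k g y) x <= exp L * ((Nat.iter k g t - e) / (t - s)).
Proof.
intros Hl HL HLp Hgt Hst Het Hes Hte k x Hx.
destruct (MVT_Derive _ s t (lift_ex_derive _ (Hl k))) as [c [Hc E]].
rewrite Rmin_left, Rmax_right in Hc by lra.
assert (D := iter_distortion g L s t Hl HL HLp Hgt k x c Hx Hc).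
assert (Hpx := lift_Derive_pos _ (Hl k) x). assert (Hpc := lift_Derive_pos _ (Hl k) c).
assert (H1 : Rabs (ln (Derive (fun y => Nat.iter k g y) x)
   - ln (Derive (fun y => Nat.iter k g y) c)) <= L).
{ apply Rle_trans with (1 := D). rewrite <- (Rmult_1_r L) at 2.
  apply Rmult_le_compat_l; [lra|]. specialize (Het k). lra. }
apply Rle_trans with (1 := ratio_of_log _ _ _ Hpx Hpc H1).
apply Rmult_le_compat_l; [left; apply exp_pos|].
apply (Rmult_le_reg_r (t - s)); [lra|]. rewrite <- E.
replace ((Nat.iter k g t - e) / (t - s) * (t - s)) with (Nat.iter k g t - e) by (field; lra).
specialize (Hes k). lra.
Qed.

(** Derivatives of lifts are positive, so for a lift this makes [phi] a self-map of [[s, t]] with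
    Lipschitz constant [1 / 2]. *)
Definition contracts (s t : R) (phi : R -> R) : Prop :=
  forall x, s <= x <= t -> s <= phi x <= t /\ Derive phi x <= 1 / 2.

Lemma continuity_pt_below (g : R -> R) (x b : R) : continuity_pt g x -> g x < b ->
  exists d, 0 < d /\ forall y, Rabs (y - x) < d -> g y < b.
Proof.
intros Hc Hb. destruct (Hc (b - g x)) as [d [Hd H]]; [lra|].
exists d. split; [exact Hd|]. intros y Hy.
destruct (Req_dec x y) as [<-|Hne]; [exact Hb|].
assert (H1 : Rabs (g y - g x) < b - g x).
{ apply (H y). split; [split; [exact I | exact Hne] | exact Hy]. }
apply Rabs_def2 in H1. lra.
Qed.

(* If [g] contracts to [e] a one-sided neighbourhood [(e, t]] containing [h e], then [h g^k]
   contracts a neighbourhood of [h e] for every large [k]. *)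
Lemma contracting_pair_exists G B f :
  lift_subgroup G -> ~ has_finite_orbit G -> closed_invariant G B ->
  G f -> (exists x, f x <> x) -> (exists e, B e /\ f e = e) ->
  exists z s t phi1 phi2 p1 p2, B z /\ s < z < t /\ t - s <= 1 /\
    G phi1 /\ G phi2 /\ contracts s t phi1 /\ contracts s t phi2 /\
    s <= p1 <= t /\ s <= p2 <= t /\ phi1 p1 = p1 /\ phi2 p2 = p2 /\ p1 <> p2.
Proof.
intros HG Hno HB Hf Hnt Hfix.
destruct (fixed_point_returning_beside_itself G B f HG Hno HB Hf Hnt Hfix)
  as [e [h [HBe [Hfe [Hh [Hlt Hnf]]]]]].
assert (Hfl := group_lift G f HG Hf). assert (Hfc := lift_continuity f Hfl).
assert (Hhl := group_lift G h HG Hh).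
set (z := h e) in *.
destruct (nonfixed_open f z Hfc) as [d0 [Hd0 Hnd]]; [apply Hnf; lra|].
assert (Hnf' : forall y, e < y <= z + d0 / 2 -> f y <> y).
{ intros y Hy. destruct (Rle_lt_dec y z); [apply Hnf; lra|]. apply Hnd. apply Rabs_def1; lra. }
destruct (contracting_orientation G f e (z + d0 / 2) HG Hf Hfe) as [g [Hg [Hge Hgy]]];
  [lra | exact Hnf' |].
assert (Hl : forall n, lift (fun y => Nat.iter n g y))
  by (intros n; apply (group_lift G); [exact HG | apply group_iter; assumption]).
assert (Hgl : lift g) by exact (Hl 1%nat). assert (Hgc := lift_continuity g Hgl).
destruct (continuity_pt_below g z z (Hgc z)) as [d1 [Hd1 Hgz]]; [apply Hgy; lra|].
set (t := z + Rmin (d0 / 2) (d1 / 2)).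
assert (Ht : z < t /\ t <= z + d0 / 2 /\ g t < z).
{ assert (Hm1 := Rmin_l (d0 / 2) (d1 / 2)). assert (Hm2 := Rmin_r (d0 / 2) (d1 / 2)).
  assert (Hm3 : 0 < Rmin (d0 / 2) (d1 / 2)) by (apply Rmin_pos; lra).
  unfold t. split; [lra|]. split; [lra|]. apply Hgz. apply Rabs_def1; lra. }
destruct Ht as [Hzt [Htd Hgt]].
assert (Hgy' : forall y, e < y <= t -> g y < y) by (intros; apply Hgy; lra).
(* [g] also fixes [e + 1], which therefore lies beyond [t]. *)
assert (Het : t - e <= 1).
{ destruct (Rle_lt_dec (t - e) 1) as [|Hc]; [assumption|]. exfalso.
  assert (H1 : g (e + 1) < e + 1) by (apply Hgy'; lra).
  rewrite (lift_shift g Hgl 1), Hge in H1. lra. }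
assert (Hegt : e < g t) by (rewrite <- Hge at 1; apply lift_incr; [exact Hgl | lra]).
(* Between [g t] and [z]: the iterates of [[s, t]] do not overlap, and [z] stays interior. *)
set (s := (g t + z) / 2).
assert (Hs : g t < s /\ s < z /\ e < s) by (unfold s; lra).
destruct Hs as [Hgts [Hsz Hes]].
assert (Hbt : forall k, e < Nat.iter k g t)
  by (intros k; apply (iter_between g e t k); auto using lift_incr; lra).
assert (Hbs : forall k, e < Nat.iter k g s).
{ intros k. apply (iter_between g e s k); auto using lift_incr. intros; apply Hgy'; lra. }
destruct (lift_log_Derive_lipschitz g Hgl) as [L [HLp HL]].
assert (HD : forall k x, s <= x <= t ->
  Derive (fun y => Nat.iter k g y) x <= exp L * ((Nat.iter k g t - e) / (t - s)))
  by (intros k x Hx; apply iter_Derive_bound; auto; lra).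
destruct (lift_Derive_bounds h Hhl) as [m [M [Hm HM]]].
assert (HMp : 0 < M) by (specialize (HM 0); lra).
destruct (lift_lipschitz h Hhl) as [M' [HM' HLip]].
assert (HeL := exp_pos L).
(* Used with [b = t] and then with [b = p1], so that the second fixed point lies strictly between
   [z] and the first. *)
assert (step : forall b, z < b <= t -> exists phi p, G phi /\ contracts s t phi /\
   s <= p <= t /\ phi p = p /\ z < p < b).
{ intros b Hb.
  (* The first term brings the derivative of [h g^K] down to [1 / 2]; the second puts the image of
     [[s, t]] to the left of [b]. *)
  set (eta := Rmin ((t - s) / (2 * M * exp L)) ((b - z) / M')).
  assert (Heta : 0 < eta).
  { apply Rmin_pos; apply Rdiv_lt_0_compat; try lra.
    apply Rmult_lt_0_compat; lra. }
  destruct (iter_tends_to_fixed g e t Hgc (lift_incr g Hgl) Hge Hgy' ltac:(lra) eta Heta)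
    as [K HK]. specialize (HK K (le_n K)).
  set (phi := fun x => h (Nat.iter K g x)).
  assert (Hphi : G phi) by (apply (group_comp G h (fun x => Nat.iter K g x) HG Hh),
    group_iter; assumption).
  assert (Hpl := group_lift G phi HG Hphi).
  assert (Hval : forall x, s <= x <= t -> z < phi x < b).
  { intros x Hx. split.
    - unfold z, phi. apply lift_incr; [exact Hhl|].
      apply Rlt_le_trans with (1 := Hbs K). apply (lift_incr_le _ (Hl K)). lra.
    - apply Rle_lt_trans with (phi t); [apply lift_incr_le; [exact Hpl | lra]|].
      unfold phi. specialize (HLip (Nat.iter K g t) e). fold z in HLip.
      assert (H1 := Rle_abs (h (Nat.iter K g t) - z)).
      rewrite (Rabs_pos_eq (Nat.iter K g t - e)) in HLip by lra.
      assert (H2 : M' * (Nat.iter K g t - e) < b - z); [|lra].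
      replace (b - z) with (M' * ((b - z) / M')) by (field; lra).
      apply Rmult_lt_compat_l; [lra|].
      assert (H3 := Rmin_r ((t - s) / (2 * M * exp L)) ((b - z) / M')).
      fold eta in H3. lra. }
  destruct (fixed_point_between phi s t) as [p [Hp Ep]].
  - apply lift_continuity, Hpl.
  - lra.
  - assert (H1 := Hval s). assert (H2 := Hval t). nra.
  - exists phi, p. split; [exact Hphi|]. split; [|split; [lra|split; [exact Ep|]]].
    + intros x Hx. split; [specialize (Hval x Hx); lra|].
      unfold phi. rewrite (Derive_lift_comp h (fun x => Nat.iter K g x)) by (try exact Hhl; apply Hl).
      specialize (HD K x Hx). destruct (HM (Nat.iter K g x)) as [HM1 HM2].
      assert (Hpos := lift_Derive_pos _ (Hl K) x).
      apply Rle_trans with (M * (exp L * ((Nat.iter K g t - e) / (t - s)))).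
      { apply Rmult_le_compat; lra. }
      apply Rle_trans with (M * (exp L * (((t - s) / (2 * M * exp L)) / (t - s)))).
      { apply Rmult_le_compat_l; [lra|]. apply Rmult_le_compat_l; [lra|].
        apply Rmult_le_compat_r; [left; apply Rinv_0_lt_compat; lra|].
        assert (H3 := Rmin_l ((t - s) / (2 * M * exp L)) ((b - z) / M')).
        fold eta in H3. lra. }
      right. field. lra.
    + rewrite <- Ep. apply Hval. exact Hp. }
destruct (step t) as [phi1 [p1 [G1 [C1 [P1 [E1 Z1]]]]]]; [lra|].
destruct (step p1) as [phi2 [p2 [G2 [C2 [P2 [E2 Z2]]]]]]; [lra|].
exists z, s, t, phi1, phi2, p1, p2.
repeat split; try assumption; try lra; try apply C1; try apply C2; try assumption.
apply (proj1 HB); assumption.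
Qed.

(** * Almost-translations *)

(** The word [sigma 0 o ... o sigma (k - 1)]. New letters enter on the inside, so the images of an
    interval preserved by all letters are nested. *)
Fixpoint compose_prefix (sigma : nat -> R -> R) (k : nat) (x : R) : R :=
  match k with
  | O => x
  | S j => compose_prefix sigma j (sigma j x)
  end.

Lemma compose_prefix_group G sigma : lift_subgroup G -> (forall k, G (sigma k)) ->
  forall k, G (compose_prefix sigma k).
Proof.
intros HG Hs. induction k as [|k IH].
- exact (proj1 (proj2 HG)).
- exact (group_comp G _ _ HG IH (Hs k)).
Qed.

Lemma contracts_lipschitz s t phi x y : lift phi -> contracts s t phi ->
  s <= x <= t -> s <= y <= t -> Rabs (phi x - phi y) <= 1 / 2 * Rabs (x - y).
Proof.
intros Hl Hc Hx Hy. destruct (MVT_Derive phi y x (lift_ex_derive _ Hl)) as [c [Hcc E]].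
rewrite E, Rabs_mult. apply Rmult_le_compat_r; [apply Rabs_pos|].
assert (Hm := Rmin_glb y x s ltac:(lra) ltac:(lra)). assert (HM := Rmax_lub y x t ltac:(lra) ltac:(lra)).
destruct (Hc c) as [_ H]; [lra|].
rewrite Rabs_pos_eq; [exact H | left; apply lift_Derive_pos, Hl].
Qed.

(** Each letter halves distances before the earlier ones act, so the distortions form a geometric
    series: [L + 2 L / 2 = 2 L]. *)
Lemma compose_prefix_distortion G sigma s t L : lift_subgroup G -> (forall k, G (sigma k)) ->
  (forall k, contracts s t (sigma k)) -> 0 < L ->
  (forall k x y, Rabs (ln (Derive (sigma k) x) - ln (Derive (sigma k) y)) <= L * Rabs (x - y)) ->
  forall k x y, s <= x <= t -> s <= y <= t ->
  Rabs (ln (Derive (compose_prefix sigma k) x) - ln (Derive (compose_prefix sigma k) y))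
    <= 2 * L * Rabs (x - y).
Proof.
intros HG Hs Hc HLp HL. induction k as [|k IH]; intros x y Hx Hy.
- simpl. change (compose_prefix sigma 0) with (fun x : R => x). rewrite !Derive_id, Rminus_diag, Rabs_R0.
  apply Rmult_le_pos; [lra | apply Rabs_pos].
- assert (Hk := group_lift G _ HG (Hs k)).
  assert (Hp := group_lift G _ HG (compose_prefix_group G sigma HG Hs k)).
  change (compose_prefix sigma (S k)) with (fun x => compose_prefix sigma k (sigma k x)).
  rewrite !(Derive_lift_comp (compose_prefix sigma k) (sigma k)) by assumption.
  rewrite !ln_mult by (apply lift_Derive_pos; assumption).
  specialize (IH (sigma k x) (sigma k y) (proj1 (Hc k x Hx)) (proj1 (Hc k y Hy))).
  assert (H1 := contracts_lipschitz s t (sigma k) x y Hk (Hc k) Hx Hy).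
  specialize (HL k x y).
  match goal with |- Rabs (?a + ?b - (?c + ?d)) <= _ =>
    replace (a + b - (c + d)) with ((a - c) + (b - d)) by ring end.
  apply Rle_trans with (1 := Rabs_triang _ _).
  assert (2 * L * Rabs (sigma k x - sigma k y) <= 2 * L * (1 / 2 * Rabs (x - y)))
    by (apply Rmult_le_compat_l; lra).
  lra.
Qed.

(** At the first [k] with [D k <= eta], the value has overshot by at most the factor [m] of a single
    step. *)
Lemma geometric_scale (D : nat -> R) (m eta : R) :
  D 0%nat = 1 -> (forall k, 0 < D k) -> (forall k, m * D k <= D (S k) <= 1 / 2 * D k) ->
  0 < eta < 1 -> 0 < m -> exists k, m * eta <= D k <= eta.
Proof.
intros H0 Hp Hs Heta Hm.
assert (Hex : exists k, D k <= eta).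
{ apply NNPP; intros Hn.
  assert (Hlow : forall k, eta < D k) by
    (intros k; destruct (Rle_lt_dec (D k) eta); [exfalso; eauto | assumption]).
  assert (Hlin : forall k, D k <= 1 - INR k * (eta / 2)).
  { induction k as [|k IH]; [simpl; lra|]. rewrite S_INR.
    specialize (Hs k). specialize (Hlow k). lra. }
  assert (eta / 2 <= 0); [|lra]. apply bounded_multiples_zero with 1. intros n.
  specialize (Hlin n). specialize (Hp n). lra. }
destruct Hex as [n Hn]. induction n as [|n IH]; [lra|].
destruct (Rle_lt_dec (D n) eta) as [H|H]; [apply IH, H|].
exists (S n). split; [|exact Hn]. apply Rle_trans with (m * D n); [|apply Hs].
apply Rmult_le_compat_l; lra.
Qed.

(* Renormalization: on the scale [D = psi'(r)] a displacement of size [d D] of [F] near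
   [psi r] becomes a displacement of size [d] of [psi^-1 F psi] on the whole of [[s, t']]. *)
Lemma conjugate_is_almost_translation G psi F s t t' r C kappa d eps :
  lift_subgroup G -> G psi -> G F -> t - s <= 1 -> s <= r <= t -> 0 < C -> 1 / 2 <= kappa ->
  (forall x y, s <= x <= t -> s <= y <= t ->
    Rabs (ln (Derive psi x) - ln (Derive psi y)) <= C * Rabs (x - y)) ->
  near_id eps F -> 0 < d ->
  d * Derive psi r <= F (psi r) - psi r <= kappa * d * Derive psi r ->
  eps <= d * exp (- C) / 2 -> t' <= t -> 2 * kappa * exp C * d <= t - t' ->
  exists T, G T /\
    (forall x, s <= x <= t' -> exp (- C) / 2 * d <= T x - x <= 2 * kappa * exp C * d) /\
    (forall x y, s <= x <= t' -> s <= y <= t' ->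
      Rabs (T x - T y) <= exp ((C * (2 * kappa * exp C) + 1) * d) * Rabs (x - y)).
Proof.
intros HG Hpsi HF Hts Hr HC Hka Hdist Hn Hd Hup Heps Ht' Hmar.
destruct (group_inv G psi HG Hpsi) as [Q [HQ [EQ1 EQ2]]].
set (T := fun x => Q (F (psi x))).
assert (HT : G T) by (apply (group_comp G Q (fun x => F (psi x)) HG HQ), group_comp; assumption).
assert (Hpl := group_lift G psi HG Hpsi). assert (HFl := group_lift G F HG HF).
assert (HTl := group_lift G T HG HT).
assert (ET : forall x, psi (T x) = F (psi x)) by (intros x; apply EQ2).
set (D := Derive psi r) in *.
assert (HD : 0 < D) by apply lift_Derive_pos, Hpl.
assert (HeC := exp_pos C). assert (HeC' := exp_pos (- C)).
assert (Eee : exp C * exp (- C) = 1) by (rewrite <- exp_plus, Rplus_opp_r; apply exp_0).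
assert (HeC1 : exp (- C) <= 1) by (rewrite <- exp_0; left; apply exp_increasing; lra).
assert (HdD : 0 < d * D) by (apply Rmult_lt_0_compat; assumption).
assert (Hder : forall c, s <= c <= t -> exp (- C) * D <= Derive psi c <= exp C * D).
{ intros c Hc. assert (Hpc := lift_Derive_pos psi Hpl c).
  assert (Hlog : Rabs (ln (Derive psi c) - ln D) <= C).
  { apply Rle_trans with (1 := Hdist c r Hc Hr). rewrite <- (Rmult_1_r C) at 2.
    apply Rmult_le_compat_l; [lra|]. apply Rabs_le; lra. }
  assert (H1 := ratio_of_log _ _ _ Hpc HD Hlog).
  rewrite Rabs_minus_sym in Hlog. assert (H2 := ratio_of_log _ _ _ HD Hpc Hlog).
  split; [|exact H1].
  apply Rle_trans with (exp (- C) * (exp C * Derive psi c));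
    [apply Rmult_le_compat_l; lra | right].
  rewrite <- Rmult_assoc, (Rmult_comm (exp (- C))), Eee. ring. }
assert (Hinc : forall x y, s <= x -> x <= y -> y <= t ->
   exp (- C) * D * (y - x) <= psi y - psi x <= exp C * D * (y - x)).
{ intros x y Hx Hxy Hy. destruct (MVT_Derive psi x y (lift_ex_derive _ Hpl)) as [c [Hc E]].
  rewrite Rmin_left, Rmax_right in Hc by lra. rewrite E.
  destruct (Hder c); [lra|]. split; apply Rmult_le_compat_r; lra. }
assert (HED : 0 < exp C * D) by (apply Rmult_lt_0_compat; assumption).
assert (Hvar : forall x, s <= x <= t -> Rabs (psi x - psi r) <= exp C * D).
{ intros x Hx. destruct (Rle_lt_dec x r) as [H|H].
  - rewrite Rabs_minus_sym, Rabs_pos_eq by (assert (H1 := lift_incr_le psi Hpl x r H); lra).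
    destruct (Hinc x r) as [_ H1]; try lra.
    assert (exp C * D * (r - x) <= exp C * D * 1) by (apply Rmult_le_compat_l; lra). lra.
  - rewrite Rabs_pos_eq by (assert (H1 := lift_incr psi Hpl r x H); lra).
    destruct (Hinc r x) as [_ H1]; try lra.
    assert (exp C * D * (x - r) <= exp C * D * 1) by (apply Rmult_le_compat_l; lra). lra. }
(* [F' - 1] is at most [d exp (- C) / 2] in size and [psi x] is within [exp C * D] of [psi r], so
   the displacement of [F] varies by at most [d D / 2]. *)
assert (Hu : forall x, s <= x <= t -> d * D / 2 <= F (psi x) - psi x <= 2 * kappa * (d * D)).
{ intros x Hx.
  destruct (MVT_Derive F (psi r) (psi x) (lift_ex_derive _ HFl)) as [c [_ E]].
  assert (Hb : Rabs ((F (psi x) - psi x) - (F (psi r) - psi r)) <= d * D / 2).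
  { replace ((F (psi x) - psi x) - (F (psi r) - psi r))
      with ((Derive F c - 1) * (psi x - psi r)) by lra.
    rewrite Rabs_mult.
    apply Rle_trans with (d * exp (- C) / 2 * (exp C * D)).
    - apply Rmult_le_compat; try apply Rabs_pos; [|apply Hvar, Hx].
      apply Rlt_le, Rlt_le_trans with eps; [apply Hn | exact Heps].
    - right. replace (d * exp (- C) / 2 * (exp C * D)) with (d * D / 2 * (exp C * exp (- C))) by field.
      rewrite Eee. ring. }
  apply Rabs_le_between in Hb. nra. }
exists T. split; [exact HT|].
assert (Hbig : exp (- C) / 2 * d <= 2 * kappa * exp C * d).
{ apply Rmult_le_compat_r; [lra|].
  assert (1 <= exp C) by (rewrite <- exp_0; left; apply exp_increasing; lra). nra. }
(* Stopping at [t'] keeps [x + 2 kappa exp C d] inside [[s, t]], where the bounds on [psi] hold. *)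
assert (Hdisp : forall x, s <= x <= t' ->
   exp (- C) / 2 * d <= T x - x <= 2 * kappa * exp C * d).
{ intros x Hx. destruct (Hu x) as [Hu1 Hu2]; [lra|].
  assert (Hc1 : 0 < exp (- C) / 2 * d) by (apply Rmult_lt_0_compat; lra).
  split.
  - assert (x + exp (- C) / 2 * d <= T x); [|lra].
    apply (lift_le_inv psi Hpl). rewrite ET.
    destruct (Hinc x (x + exp (- C) / 2 * d)) as [_ H]; try lra.
    replace (exp C * D * (x + exp (- C) / 2 * d - x))
      with (d * D / 2 * (exp C * exp (- C))) in H by field.
    rewrite Eee in H. lra.
  - assert (T x <= x + 2 * kappa * exp C * d); [|lra].
    apply (lift_le_inv psi Hpl). rewrite ET.
    destruct (Hinc x (x + 2 * kappa * exp C * d)) as [H _]; try lra.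
    replace (exp (- C) * D * (x + 2 * kappa * exp C * d - x))
      with (2 * kappa * (d * D) * (exp C * exp (- C))) in H by field.
    rewrite Eee in H. lra. }
split; [exact Hdisp|].
intros x y Hx Hy.
destruct (MVT_Derive T y x (lift_ex_derive _ HTl)) as [c [Hc E]].
rewrite E, Rabs_mult. apply Rmult_le_compat_r; [apply Rabs_pos|].
assert (Hcc : s <= c <= t').
{ assert (H1 := Rmin_glb y x s ltac:(lra) ltac:(lra)). assert (H2 := Rmax_lub y x t' ltac:(lra) ltac:(lra)). lra. }
destruct (Hdisp c Hcc) as [Hd1 Hd2].
assert (Hc1 : 0 < exp (- C) / 2 * d) by (apply Rmult_lt_0_compat; lra).
assert (HpT := lift_Derive_pos T HTl c).
assert (HpTc := lift_Derive_pos psi Hpl (T c)). assert (Hpc := lift_Derive_pos psi Hpl c).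
rewrite Rabs_pos_eq by lra.
(* [T'(c)] is [F'(psi c)] times [psi'(c) / psi'(T c)]; both factors are at most [exp (O(d))], the
   second because [T c - c] is [O(d)]. *)
assert (Hchain : Derive psi (T c) * Derive T c = Derive F (psi c) * Derive psi c).
{ rewrite <- (Derive_lift_comp psi T), <- (Derive_lift_comp F psi) by assumption.
  apply Derive_ext, ET. }
assert (HF1 : Derive F (psi c) <= exp d).
{ destruct (Hn (psi c)) as [_ H]. apply Rabs_def2 in H.
  assert (H1 := exp_ineq1_le d). assert (eps <= d) by nra. lra. }
assert (Hps : Derive psi c <= exp (C * (2 * kappa * exp C * d)) * Derive psi (T c)).
{ apply ratio_of_log; try assumption.
  apply Rle_trans with (1 := Hdist c (T c) ltac:(lra) ltac:(lra)).
  apply Rmult_le_compat_l; [lra|]. rewrite Rabs_minus_sym, Rabs_pos_eq; lra. }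
apply (Rmult_le_reg_l (Derive psi (T c))); [exact HpTc|]. rewrite Hchain.
replace (exp ((C * (2 * kappa * exp C) + 1) * d))
  with (exp d * exp (C * (2 * kappa * exp C * d))) by (rewrite <- exp_plus; f_equal; ring).
apply Rle_trans with (exp d * (exp (C * (2 * kappa * exp C * d)) * Derive psi (T c))).
- apply Rmult_le_compat; try lra. left; apply lift_Derive_pos, HFl.
- right; ring.
Qed.

(** The Lipschitz constant is tuned to the displacement: the [O(1 / d)] iterates that cross the
    interval have Lipschitz constants bounded independently of [d]. *)
Definition almost_translation (a b c1 c2 c3 d : R) (T : R -> R) : Prop :=
  (forall x, a <= x <= b -> c1 * d <= T x - x <= c2 * d) /\
  (forall x y, a <= x <= b -> a <= y <= b -> Rabs (T x - T y) <= exp (c3 * d) * Rabs (x - y)).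

(** Pick [F] very close to the identity and a point [q = phi2^i p1] that it moves, then conjugate
    [F] by a word [phi2^i phi1^n] or a prefix of it, zooming in on [q] until the displacement has
    size [d]. The constants depend only on [phi1] and [phi2]. *)
Lemma local_translations G s t phi1 phi2 p1 p2 :
  lift_subgroup G -> C1_nondiscrete G -> t - s <= 1 ->
  G phi1 -> G phi2 -> contracts s t phi1 -> contracts s t phi2 ->
  s <= p1 <= t -> s <= p2 <= t -> phi1 p1 = p1 -> phi2 p2 = p2 -> p1 <> p2 ->
  exists c1 c2 c3, 0 < c1 /\ 0 < c2 /\ 0 < c3 /\ forall t', t' < t ->
    exists d0, 0 < d0 /\ forall d, 0 < d < d0 ->
      exists T, G T /\ almost_translation s t' c1 c2 c3 d T.
Proof.
intros HG HC1 Hts G1 G2 C1 C2 P1 P2 E1 E2 Hne.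
assert (L1 := group_lift G _ HG G1). assert (L2 := group_lift G _ HG G2).
destruct (lift_log_Derive_lipschitz phi1 L1) as [La [HLa Hlog1]].
destruct (lift_log_Derive_lipschitz phi2 L2) as [Lb [HLb Hlog2]].
destruct (lift_Derive_bounds phi1 L1) as [ma [Ma [Hma Hb1]]].
destruct (lift_Derive_bounds phi2 L2) as [mb [Mb [Hmb Hb2]]].
set (L := La + Lb). set (m := Rmin ma mb).
assert (HL : 0 < L) by (unfold L; lra).
assert (Hm : 0 < m) by (apply Rmin_pos; assumption).
assert (Hm1 : m <= ma) by apply Rmin_l. assert (Hm2 : m <= mb) by apply Rmin_r.
set (C := 2 * L). assert (HC : 0 < C) by (unfold C; lra).
assert (Hm12 : m <= 1 / 2) by (destruct (C1 p1 P1) as [_ H]; specialize (Hb1 p1); lra).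
(* The loss in [geometric_scale]: one letter shrinks the derivative by at most the factor [m]. *)
set (kappa := / m).
assert (Hmk : m * kappa = 1) by (unfold kappa; field; lra).
assert (Hka : 1 / 2 <= kappa) by nra.
assert (HeC := exp_pos C). assert (HeC' := exp_pos (- C)).
exists (exp (- C) / 2), (2 * kappa * exp C), (C * (2 * kappa * exp C) + 1).
assert (Hc2 : 0 < 2 * kappa * exp C) by (apply Rmult_lt_0_compat; lra).
split; [lra|]. split; [exact Hc2|]. split; [nra|].
intros t' Ht'.
exists ((t - t') / (2 * kappa * exp C)).
split; [apply Rdiv_lt_0_compat; lra|]. intros d [Hd Hd'].
apply (Rmult_lt_compat_l (2 * kappa * exp C)) in Hd'; [|exact Hc2].
replace (2 * kappa * exp C * ((t - t') / (2 * kappa * exp C))) with (t - t') in Hd' by (field; lra).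
set (eps := d * exp (- C) / 2).
assert (Heps : 0 < eps) by (unfold eps; assert (H := Rmult_lt_0_compat _ _ Hd HeC'); lra).
assert (Hed : eps < d).
{ unfold eps. assert (HeC1 : exp (- C) < 1) by (rewrite <- exp_0; apply exp_increasing; lra). nra. }
destruct (near_identity_pair G HG HC1 eps Heps) as [F [H [HF [HH [EHF [EFH [HFn [NF NH]]]]]]]].
assert (Hq : forall i, s <= Nat.iter i phi2 p1 <= t).
{ induction i as [|i IH]; [exact P1 | exact (proj1 (C2 _ IH))]. }
(* The points [phi2^i p1] tend to [p2] without reaching it, and fixed points of [F] are isolated. *)
assert (Hi : exists i, F (Nat.iter i phi2 p1) <> Nat.iter i phi2 p1).
{ destruct (lift_fixed_isolated F (group_lift G F HG HF) HFn p2) as [e [He Hiso]].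
  assert (Hpos : forall i, 0 < Rabs (Nat.iter i phi2 p1 - p2)).
  { intros i. apply Rabs_pos_lt, Rminus_eq_contra. induction i as [|i IH]; [exact Hne|].
    simpl. intros E. apply IH. rewrite <- E2 in E.
    destruct (Rtotal_order (Nat.iter i phi2 p1) p2) as [Hlt|[Heq|Hlt]]; [|exact Heq|];
      apply (lift_incr phi2 L2) in Hlt; lra. }
  assert (Hex : exists i, Rabs (Nat.iter i phi2 p1 - p2) < e).
  { apply NNPP; intros Hn.
    assert (Hlow : forall i, e <= Rabs (Nat.iter i phi2 p1 - p2)) by
      (intros i; destruct (Rle_lt_dec e (Rabs (Nat.iter i phi2 p1 - p2))); [assumption | exfalso; eauto]).
    assert (Hlin : forall i, Rabs (Nat.iter i phi2 p1 - p2) <= 1 - INR i * (e / 2)).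
    { induction i as [|i IH].
      - simpl. assert (Rabs (p1 - p2) <= t - s) by (apply Rabs_diff_interval; assumption). lra.
      - rewrite S_INR. simpl. rewrite <- E2 at 1.
        assert (H1 := contracts_lipschitz s t phi2 _ _ L2 C2 (Hq i) P2).
        specialize (Hlow i). lra. }
    assert (e / 2 <= 0); [|lra]. apply bounded_multiples_zero with 1. intros n.
    specialize (Hlin n). specialize (Hpos n). lra. }
  destruct Hex as [i Hie]. exists i. apply Hiso. split; [apply Hpos | exact Hie]. }
destruct Hi as [i Hi]. set (q := Nat.iter i phi2 p1) in *.
assert (HF' : exists F', G F' /\ near_id eps F' /\ q < F' q).
{ destruct (Rtotal_order (F q) q) as [Hlt|[Heq|Hlt]]; [|contradiction|exists F; auto].
  exists H. split; [exact HH|]. split; [exact NH|].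
  apply (lift_lt_inv F (group_lift G F HG HF)). rewrite EFH. exact Hlt. }
destruct HF' as [F' [HGF' [NF' HFq]]].
(* The infinite word [phi2^i phi1 phi1 ...]. The point [r k] is the preimage of [q] under its prefix
   of length [k]; truncated subtraction makes it [p1] from [k = i] on. *)
set (sigma := fun k => if (k <? i)%nat then phi2 else phi1).
set (r := fun k => Nat.iter (i - k) phi2 p1).
assert (Hsig : forall k, sigma k = phi1 \/ sigma k = phi2)
  by (intros k; unfold sigma; destruct (k <? i)%nat; auto).
assert (HsG : forall k, G (sigma k)) by (intros k; destruct (Hsig k) as [->| ->]; assumption).
assert (HsC : forall k, contracts s t (sigma k))
  by (intros k; destruct (Hsig k) as [->| ->]; assumption).
assert (HsL : forall k x y, Rabs (ln (Derive (sigma k) x) - ln (Derive (sigma k) y))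
   <= L * Rabs (x - y)).
{ intros k x y. assert (Hxy := Rabs_pos (x - y)). unfold L.
  destruct (Hsig k) as [->| ->]; [specialize (Hlog1 x y) | specialize (Hlog2 x y)]; nra. }
assert (Hsm : forall k x, m <= Derive (sigma k) x).
{ intros k x. destruct (Hsig k) as [->| ->]; [specialize (Hb1 x) | specialize (Hb2 x)]; lra. }
assert (Hrs : forall k, sigma k (r (S k)) = r k).
{ intros k. unfold sigma, r. destruct (Nat.ltb_spec k i) as [Hk|Hk].
  - replace (i - k)%nat with (S (i - S k)) by lia. reflexivity.
  - replace (i - k)%nat with 0%nat by lia. replace (i - S k)%nat with 0%nat by lia. exact E1. }
assert (Hpr : forall k, compose_prefix sigma k (r k) = q).
{ induction k as [|k IH]; [unfold r; rewrite Nat.sub_0_r; reflexivity|].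
  simpl. rewrite Hrs. exact IH. }
assert (HpG := compose_prefix_group G sigma HG HsG).
assert (Hrr : forall k, s <= r k <= t) by (intros k; apply Hq).
(* The scale at which the displacement [F' q - q] is between [d] and [kappa d] times the derivative
   of the prefix. *)
destruct (geometric_scale (fun k => Derive (compose_prefix sigma k) (r k)) m ((F' q - q) / d))
  as [k [Hk1 Hk2]].
- apply Derive_id.
- intros k. apply lift_Derive_pos, (group_lift G); [exact HG | apply HpG].
- intros k. change (compose_prefix sigma (S k)) with (fun x => compose_prefix sigma k (sigma k x)).
  rewrite (Derive_lift_comp (compose_prefix sigma k) (sigma k)), Hrs by (apply (group_lift G); auto).
  assert (Hp := lift_Derive_pos _ (group_lift G _ HG (HpG k)) (r k)).
  destruct (HsC k (r (S k)) (Hrr _)) as [_ Hup]. specialize (Hsm k (r (S k))). nra.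
- destruct (NF' q) as [H1 _]. apply Rabs_def2 in H1. split; [apply Rdiv_lt_0_compat; lra|].
  apply (Rmult_lt_reg_r d); [exact Hd|]. unfold Rdiv. rewrite Rmult_assoc, Rinv_l by lra. lra.
- exact Hm.
- destruct (conjugate_is_almost_translation G (compose_prefix sigma k) F' s t t' (r k) C kappa d eps)
    as [T [HT [HT1 HT2]]]; auto; try lra.
  + intros x y Hx Hy. apply (compose_prefix_distortion G sigma s t L); assumption.
  + rewrite Hpr.
    apply (Rmult_le_compat_r d) in Hk1; [|lra]. apply (Rmult_le_compat_r d) in Hk2; [|lra].
    unfold Rdiv in Hk1, Hk2. rewrite !Rmult_assoc, Rinv_l in Hk1 by lra.
    rewrite !Rmult_assoc, Rinv_l in Hk2 by lra.
    split; [lra|]. apply (Rmult_le_compat_l kappa) in Hk1; [|lra].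
    replace (kappa * (m * ((F' q - q) * 1))) with ((m * kappa) * (F' q - q)) in Hk1 by ring.
    rewrite Hmk in Hk1. lra.
  + unfold eps; lra.
  + exists T. split; [exact HT|]. split; assumption.
Qed.

(** * Minimality *)

Lemma closed_gap_left_end (A : R -> Prop) (x y : R) :
  (forall x, (forall e, 0 < e -> exists y, A y /\ Rabs (y - x) < e) -> A x) ->
  A x -> x <= y -> ~ A y ->
  exists c, x <= c < y /\ A c /\ forall w, c < w <= y -> ~ A w.
Proof.
intros HA Hx Hxy Hy.
destruct (completeness (fun z => z <= y /\ A z)) as [c [Hub Hlub]].
- exists y. intros z [Hz _]. exact Hz.
- exists x. auto.
- assert (Hcy : c <= y) by (apply Hlub; intros z [Hz _]; exact Hz).
  assert (Hxc : x <= c) by (apply Hub; auto).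
  assert (Hc : A c).
  { apply HA. intros e He. apply NNPP; intros Hn.
    assert (c <= c - e); [|lra]. apply Hlub. intros z [Hz HAz].
    assert (z <= c) by (apply Hub; auto).
    destruct (Rle_lt_dec z (c - e)); [assumption|]. exfalso. apply Hn.
    exists z. split; [exact HAz | apply Rabs_def1; lra]. }
  exists c. split; [split; [exact Hxc|]|split; [exact Hc|]].
  + destruct Hcy as [|E]; [assumption|]. subst. contradiction.
  + intros w Hw HAw. assert (w <= c); [apply Hub; split; [lra | exact HAw] | lra].
Qed.

Lemma closed_gap_right_end (A : R -> Prop) (x y : R) :
  (forall x, (forall e, 0 < e -> exists y, A y /\ Rabs (y - x) < e) -> A x) ->
  A x -> y <= x -> ~ A y ->
  exists c, y < c <= x /\ A c /\ forall w, y <= w < c -> ~ A w.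
Proof.
intros HA Hx Hxy Hy.
destruct (closed_gap_left_end (fun w => A (- w)) (- x) (- y)) as [c [Hc [HAc Hw]]].
- intros w Hw. apply HA. intros e He. destruct (Hw e He) as [v [Hv Hd]].
  exists (- v). split; [exact Hv|]. replace (- v - - w) with (- (v - w)) by ring.
  rewrite Rabs_Ropp. exact Hd.
- rewrite Ropp_involutive. exact Hx.
- lra.
- rewrite Ropp_involutive. exact Hy.
- exists (- c). split; [lra|]. split; [exact HAc|]. intros w Hwc HAw.
  apply (Hw (- w)); [lra|]. rewrite Ropp_involutive. exact HAw.
Qed.

Lemma boundary_closed_invariant G A : lift_subgroup G -> closed_invariant G A ->
  closed_invariant G (fun x => A x /\ forall e, 0 < e -> exists y, ~ A y /\ Rabs (y - x) < e).
Proof.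
intros HG [HA1 HA2]. split.
- intros F x HF [Hx Hb]. split; [apply HA1; assumption|]. intros e He.
  destruct (lift_lipschitz F (group_lift G F HG HF)) as [M [HM HL]].
  destruct (group_inv G F HG HF) as [H [HH [E1 E2]]].
  destruct (Hb (e / M)) as [y [Hy Hd]]; [apply Rdiv_lt_0_compat; assumption|].
  exists (F y). split.
  + intros HFy. apply Hy. rewrite <- (E1 y). apply HA1; assumption.
  + apply Rle_lt_trans with (1 := HL y x). replace e with (M * (e / M)) by (field; lra).
    apply Rmult_lt_compat_l; assumption.
- intros x Hx. split.
  + apply HA2. intros e He. destruct (Hx e He) as [y [[Hy _] Hd]]. eauto.
  + intros e He. destruct (Hx (e / 2)) as [y [[_ Hy] Hd]]; [lra|].
    destruct (Hy (e / 2)) as [w [Hw Hd']]; [lra|].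
    exists w. split; [exact Hw|]. replace (w - x) with ((w - y) + (y - x)) by ring.
    apply Rle_lt_trans with (1 := Rabs_triang _ _). lra.
Qed.

(* Elements close to the identity fix the ends of a given gap of [A], and one of them
   generates a contracting pair near a boundary point of [A]; but a small almost-translation
   there maps an end of a gap into that gap. *)
Lemma closed_invariant_full G A : lift_subgroup G -> C1_nondiscrete G -> ~ has_finite_orbit G ->
  closed_invariant G A -> (exists x, A x) -> forall x, A x.
Proof.
intros HG HC1 Hno HA [x1 Hx1] y0. apply NNPP; intros Hy0.
assert (HAci := HA). destruct HA as [HA1 HA2].
destruct (frac_exists (y0 - x1)) as [k0 Hk0].
destruct (closed_gap_left_end A (x1 + IZR k0) y0) as [c [Hc [HAc Hgap]]];
  [exact HA2 | apply (closed_invariant_shift G); assumption | lra | exact Hy0 |].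
(* The boundary of [A]: the contracting pair has to sit where gaps of [A] are close by. *)
set (B := fun x => A x /\ forall e, 0 < e -> exists y, ~ A y /\ Rabs (y - x) < e).
assert (HB : closed_invariant G B) by (apply boundary_closed_invariant; assumption).
assert (HBc : B c).
{ split; [exact HAc|]. intros e He. exists (c + Rmin (e / 2) (y0 - c)).
  assert (H1 := Rmin_l (e / 2) (y0 - c)). assert (H2 := Rmin_r (e / 2) (y0 - c)).
  assert (H3 : 0 < Rmin (e / 2) (y0 - c)) by (apply Rmin_pos; lra).
  split; [apply Hgap; lra | apply Rabs_def1; lra]. }
destruct (near_identity_pair G HG HC1 (y0 - c)) as [F [H [HF [HH [EHF [EFH [HFn [NF NH]]]]]]]];
  [lra|].
(* A displacement shorter than the gap cannot carry [c] to its right without landing in the gap.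
   Applied to [F] and to its inverse, this fixes [c]. *)
assert (Hnot : forall F, G F -> near_id (y0 - c) F -> F c <= c).
{ intros F' HF' N'. destruct (Rle_lt_dec (F' c) c) as [|Hlt]; [assumption|]. exfalso.
  destruct (N' c) as [H1 _]. apply Rabs_def2 in H1.
  apply (Hgap (F' c)); [lra | apply HA1; assumption]. }
assert (HFc : F c = c).
{ apply Rle_antisym; [apply Hnot; assumption|].
  apply (lift_le_inv H (group_lift G H HG HH)). rewrite EHF. apply Hnot; assumption. }
destruct (contracting_pair_exists G B F HG Hno HB HF HFn) as
  [z [s [t [phi1 [phi2 [p1 [p2 [[HAz HBz] [Hz [Hts [G1 [G2 [C1 [C2 [P1 [P2 [E1 [E2 Hne]]]]]]]]]]]]]]]]]];
  [eauto|].
destruct (local_translations G s t phi1 phi2 p1 p2 HG HC1 Hts G1 G2 C1 C2 P1 P2 E1 E2 Hne)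
  as [c1 [c2 [c3 [Hc1 [Hc2 [Hc3 HT]]]]]].
set (t' := (z + t) / 2).
destruct (HT t') as [d0 [Hd0 HTd]]; [unfold t'; lra|].
assert (small : forall e, 0 < e -> exists T, G T /\
   forall x, s <= x <= t' -> x < T x < x + e).
{ intros e He. set (d := Rmin (d0 / 2) (e / (2 * c2))).
  assert (Hec : 0 < e / (2 * c2)) by (apply Rdiv_lt_0_compat; lra).
  assert (Hd : 0 < d) by (apply Rmin_pos; lra).
  assert (Hdl : d <= d0 / 2) by apply Rmin_l.
  assert (Hdr : d <= e / (2 * c2)) by apply Rmin_r.
  destruct (HTd d) as [T [HGT [HT1 _]]]; [lra|].
  exists T. split; [exact HGT|]. intros x Hx. specialize (HT1 x Hx).
  apply (Rmult_le_compat_l c2) in Hdr; [|lra].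
  replace (c2 * (e / (2 * c2))) with (e / 2) in Hdr by (field; lra).
  assert (0 < c1 * d) by (apply Rmult_lt_0_compat; assumption). lra. }
destruct (HBz (Rmin (z - s) (t' - z))) as [y [Hy Hyz]].
{ apply Rmin_pos; unfold t'; lra. }
assert (Hy1 := Rlt_le_trans _ _ _ Hyz (Rmin_l _ _)).
assert (Hy2 := Rlt_le_trans _ _ _ Hyz (Rmin_r _ _)).
apply Rabs_def2 in Hy1. apply Rabs_def2 in Hy2.
(* To the right of [z], [T] pushes the left end of a gap into it; to the left, the inverse of [T]
   does so with the right end. *)
destruct (Rle_lt_dec z y) as [Hzy|Hzy].
- destruct (closed_gap_left_end A z y HA2 HAz Hzy Hy) as [a [Ha [HAa Hga]]].
  destruct (small (y - a)) as [T [HGT HTs]]; [lra|].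
  specialize (HTs a ltac:(lra)).
  apply (Hga (T a)); [lra | apply HA1; assumption].
- destruct (closed_gap_right_end A z y HA2 HAz (Rlt_le _ _ Hzy) Hy) as [a [Ha [HAa Hga]]].
  destruct (small (a - y)) as [T [HGT HTs]]; [lra|].
  destruct (group_inv G T HG HGT) as [S [HGS [ES1 ES2]]].
  assert (HTl := group_lift G T HG HGT).
  apply (Hga (S a)); [|apply HA1; assumption]. split.
  + apply (lift_le_inv T HTl). rewrite ES2. specialize (HTs y ltac:(lra)). lra.
  + apply (lift_lt_inv T HTl). rewrite ES2. apply HTs. unfold t' in *; lra.
Qed.

(** The closure of an orbit is closed, invariant and nonempty, hence all of [R]. *)
Lemma orbit_dense G : lift_subgroup G -> C1_nondiscrete G -> ~ has_finite_orbit G ->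
  forall x u v, u < v -> exists h, G h /\ u < h x < v.
Proof.
intros HG HC1 Hno x u v Huv.
assert (H := closed_invariant_full G (fun w => forall e, 0 < e -> exists h, G h /\ Rabs (h x - w) < e)
  HG HC1 Hno).
destruct H with (x := (u + v) / 2) (e := (v - u) / 2) as [h [Hh Hd]].
- split.
  + intros F w HF Hw e He.
    destruct (lift_lipschitz F (group_lift G F HG HF)) as [M [HM HL]].
    destruct (Hw (e / M)) as [h [Hh Hd]]; [apply Rdiv_lt_0_compat; assumption|].
    exists (fun x => F (h x)). split; [apply group_comp; assumption|].
    apply Rle_lt_trans with (1 := HL (h x) w). replace e with (M * (e / M)) by (field; lra).
    apply Rmult_lt_compat_l; assumption.
  + intros w Hw e He. destruct (Hw (e / 2)) as [y [Hy Hd]]; [lra|].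
    destruct (Hy (e / 2)) as [h [Hh Hd']]; [lra|].
    exists h. split; [exact Hh|]. replace (h x - w) with ((h x - y) + (y - w)) by ring.
    apply Rle_lt_trans with (1 := Rabs_triang _ _). lra.
- exists x. intros e He. exists (fun y => y). split; [exact (proj1 (proj2 HG))|].
  rewrite Rminus_diag, Rabs_R0. exact He.
- lra.
- exists h. split; [exact Hh|]. apply Rabs_def2 in Hd. lra.
Qed.

(** * Contractible intervals *)

(** The pair stands for the interval [[x, y]]. An arbitrary target [(u, v)] combines shrinking and
    transport in one condition. *)
Definition contractible (G : (R -> R) -> Prop) (x y : R) : Prop :=
  forall u v, u < v -> exists h, G h /\ u < h x /\ h y < v.

Lemma contractible_sub G x y x' y' : lift_subgroup G ->
  contractible G x y -> x <= x' -> y' <= y -> contractible G x' y'.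
Proof.
intros HG H Hx Hy u v Huv. destruct (H u v Huv) as [h [Hh [H1 H2]]].
assert (Hl := group_lift G h HG Hh). exists h. split; [exact Hh|].
assert (A1 := lift_incr_le h Hl x x' Hx). assert (A2 := lift_incr_le h Hl y' y Hy). lra.
Qed.

Lemma contractible_image G F x y : lift_subgroup G -> G F ->
  contractible G x y -> contractible G (F x) (F y).
Proof.
intros HG HF H u v Huv. destruct (H u v Huv) as [h [Hh [H1 H2]]].
destruct (group_inv G F HG HF) as [Q [HQ [E _]]].
exists (fun w => h (Q w)). split; [apply group_comp; assumption|]. rewrite !E. auto.
Qed.

Lemma contractible_preimage G F x y : lift_subgroup G -> G F ->
  contractible G (F x) (F y) -> contractible G x y.
Proof.
intros HG HF H. destruct (group_inv G F HG HF) as [Q [HQ [E _]]].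
rewrite <- (E x), <- (E y). apply contractible_image; assumption.
Qed.

(** Lifts map an interval of length at least 1 to one of length at least 1, which does not fit into
    [(0, 1)]. *)
Lemma contractible_lt G x y : lift_subgroup G -> contractible G x y -> y < x + 1.
Proof.
intros HG H. destruct (H 0 1) as [h [Hh [H1 H2]]]; [lra|].
assert (Hl := group_lift G h HG Hh).
apply (lift_lt_inv h Hl). rewrite (lift_shift h Hl 1). lra.
Qed.

Lemma contracts_iter s t phi p n x : lift phi -> contracts s t phi -> s <= p <= t -> phi p = p ->
  s <= x <= t -> s <= Nat.iter n phi x <= t /\
  Rabs (Nat.iter n phi x - p) <= (1 / 2) ^ n * Rabs (x - p).
Proof.
intros Hl Hc Hp E Hx. induction n as [|n [IH1 IH2]]; [simpl; lra|]. simpl. split.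
- apply Hc, IH1.
- rewrite <- E at 1.
  assert (H := contracts_lipschitz s t phi _ _ Hl Hc IH1 Hp). lra.
Qed.

(** A power of [phi] shrinks [[s, t]] towards [p], and an element [h] provided by density takes [p]
    into the target. *)
Lemma contracted_interval_contractible G s t phi p :
  lift_subgroup G -> C1_nondiscrete G -> ~ has_finite_orbit G ->
  t - s <= 1 -> s < t -> G phi -> contracts s t phi -> s <= p <= t -> phi p = p ->
  contractible G s t.
Proof.
intros HG HC1 Hno Hts Hst Hphi Hc Hp E u v Huv.
destruct (orbit_dense G HG HC1 Hno p u v Huv) as [h [Hh Hhp]].
destruct (lift_lipschitz h (group_lift G h HG Hh)) as [M [HM HL]].
set (e := Rmin (h p - u) (v - h p) / M).
assert (He : 0 < e) by (apply Rdiv_lt_0_compat; [apply Rmin_pos; lra | exact HM]).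
destruct (pow_lt_1_zero (1 / 2)) with (y := e) as [N HN];
  [rewrite Rabs_pos_eq; lra | exact He |].
specialize (HN N (le_n N)). rewrite Rabs_pos_eq in HN by (apply pow_le; lra).
exists (fun x => h (Nat.iter N phi x)).
split; [apply (group_comp G h (fun x => Nat.iter N phi x)); [exact HG | exact Hh |
        apply group_iter; assumption]|].
assert (Hclose : forall x, s <= x <= t -> Rabs (h (Nat.iter N phi x) - h p)
   < Rmin (h p - u) (v - h p)).
{ intros x Hx.
  destruct (contracts_iter s t phi p N x (group_lift G phi HG Hphi) Hc Hp E Hx) as [_ H].
  apply Rle_lt_trans with (1 := HL _ _).
  replace (Rmin (h p - u) (v - h p)) with (M * e) by (unfold e; field; lra).
  apply Rmult_lt_compat_l; [exact HM|]. apply Rle_lt_trans with (1 := H).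
  apply Rle_lt_trans with ((1 / 2) ^ N * 1); [|lra].
  apply Rmult_le_compat_l; [apply pow_le; lra | apply Rabs_le; lra]. }
assert (H1 := Rlt_le_trans _ _ _ (Hclose s ltac:(lra)) (Rmin_l _ _)).
assert (H2 := Rlt_le_trans _ _ _ (Hclose t ltac:(lra)) (Rmin_r _ _)).
apply Rabs_def2 in H1. apply Rabs_def2 in H2. lra.
Qed.

Lemma orbit_enters_with_neighbourhood G : lift_subgroup G -> C1_nondiscrete G ->
  ~ has_finite_orbit G -> forall s t x, s < t ->
  exists h e, G h /\ 0 < e /\ forall y, x - e <= y <= x + e -> s < h y < t.
Proof.
intros HG HC1 Hno s t x Hst.
destruct (orbit_dense G HG HC1 Hno x s t Hst) as [h [Hh Hhx]].
destruct (lift_lipschitz h (group_lift G h HG Hh)) as [M [HM HL]].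
assert (Hmin : 0 < Rmin (h x - s) (t - h x)) by (apply Rmin_pos; lra).
exists h, (Rmin (h x - s) (t - h x) / (2 * M)).
assert (He : 0 < Rmin (h x - s) (t - h x) / (2 * M)) by (apply Rdiv_lt_0_compat; lra).
split; [exact Hh|]. split; [exact He|]. intros y Hy.
assert (H : Rabs (h y - h x) < Rmin (h x - s) (t - h x)).
{ apply Rle_lt_trans with (1 := HL y x).
  apply Rle_lt_trans with (M * (Rmin (h x - s) (t - h x) / (2 * M))).
  - apply Rmult_le_compat_l; [lra|]. apply Rabs_le. lra.
  - replace (M * (Rmin (h x - s) (t - h x) / (2 * M))) with (Rmin (h x - s) (t - h x) / 2)
      by (field; lra). lra. }
assert (H1 := Rlt_le_trans _ _ _ H (Rmin_l _ _)).
assert (H2 := Rlt_le_trans _ _ _ H (Rmin_r _ _)).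
apply Rabs_def2 in H1. apply Rabs_def2 in H2. lra.
Qed.

Lemma locally_contractible G s t : lift_subgroup G -> C1_nondiscrete G ->
  ~ has_finite_orbit G -> s < t -> contractible G s t ->
  forall x, exists e, 0 < e /\ contractible G (x - e) (x + e).
Proof.
intros HG HC1 Hno Hst Hc x.
destruct (orbit_enters_with_neighbourhood G HG HC1 Hno s t x Hst) as [h [e [Hh [He Hy]]]].
exists e. split; [exact He|]. apply (contractible_preimage G h); try assumption.
assert (A1 := Hy (x - e)). assert (A2 := Hy (x + e)).
apply (contractible_sub G s t); [exact HG | exact Hc | lra | lra].
Qed.

(** The supremum of the right ends that can be contracted together with [x]; contractibility of
    [[x, q]] itself is left open. *)
Definition contraction_bound (G : (R -> R) -> Prop) (x q : R) : Prop :=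
  (forall y, y < q -> contractible G x y) /\ (forall y, q < y -> ~ contractible G x y).

Lemma contraction_bound_exists G x : lift_subgroup G -> contractible G x x ->
  exists q, contraction_bound G x q.
Proof.
intros HG Hx. destruct (completeness (contractible G x)) as [q [Hub Hlub]].
- exists (x + 1). intros y Hy. left. apply (contractible_lt G); assumption.
- exists x. exact Hx.
- exists q. split.
  + intros y Hy. apply NNPP; intros Hn. assert (q <= y); [|lra].
    apply Hlub. intros w Hw. destruct (Rle_lt_dec w y); [assumption|]. exfalso. apply Hn.
    apply (contractible_sub G x w); [exact HG | exact Hw | lra | lra].
  + intros y Hy Hc. assert (y <= q) by (apply Hub; exact Hc). lra.
Qed.

Lemma contraction_bound_unique G x q q' :
  contraction_bound G x q -> contraction_bound G x q' -> q = q'.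
Proof.
intros [H1 H2] [H1' H2'].
destruct (Rtotal_order q q') as [H|[H|H]]; [exfalso | exact H | exfalso].
- apply (H2 ((q + q') / 2)); [lra | apply H1'; lra].
- apply (H2' ((q + q') / 2)); [lra | apply H1; lra].
Qed.

Lemma contraction_bound_preimage G F Q x q : lift_subgroup G -> G F -> G Q ->
  (forall y, Q (F y) = y) -> (forall y, F (Q y) = y) ->
  contraction_bound G (F x) q -> contraction_bound G x (Q q).
Proof.
intros HG HF HQ E1 E2 [H1 H2].
assert (HFl := group_lift G F HG HF). split.
- intros y Hy. apply (contractible_preimage G F); try assumption. apply H1.
  rewrite <- (E2 q). apply lift_incr; assumption.
- intros y Hy Hc. apply (H2 (F y)).
  + rewrite <- (E2 q). apply lift_incr; assumption.
  + apply contractible_image; assumption.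
Qed.

(* Were the contraction bound constant on an interval, density of orbits would make it
   locally constant everywhere, hence constant. *)
Lemma contraction_bound_not_constant G a t q : lift_subgroup G -> C1_nondiscrete G ->
  ~ has_finite_orbit G -> a < t -> contractible G a t -> contraction_bound G a q ->
  exists x0, a < x0 < t /\ contractible G x0 q.
Proof.
intros HG HC1 Hno Hat Hct Hq. apply NNPP; intros Hn.
assert (Hloc := locally_contractible G a t HG HC1 Hno Hat Hct).
assert (Hconst : forall x, a <= x < t -> contraction_bound G x q).
{ intros x Hx. destruct (Req_dec x a) as [->|Hne]; [exact Hq|]. split.
  - intros y Hy. apply (contractible_sub G a y); [exact HG | apply Hq, Hy | lra | lra].
  - intros y Hy Hc. apply Hn. exists x. split; [lra|].
    apply (contractible_sub G x y); [exact HG | exact Hc | lra | lra]. }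
assert (Hall : forall x, a <= x -> contraction_bound G x q).
{ apply real_induction. intros x Hx Hl.
  destruct (Req_dec x a) as [->|Hne].
  - exists (t - a). split; [lra|]. intros y Hy. apply Hconst. lra.
  (* By equivariance the bound is the constant [Q q] near [x], and it equals [q] just to the left of
     [x]. *)
  - destruct (orbit_enters_with_neighbourhood G HG HC1 Hno a t x Hat) as [h [e [Hh [He Hy]]]].
    destruct (group_inv G h HG Hh) as [Q [HQ [E1 E2]]].
    assert (Hb : forall y, x - e <= y <= x + e -> contraction_bound G y (Q q)).
    { intros y Hye. apply (contraction_bound_preimage G h); try assumption.
      apply Hconst. specialize (Hy y Hye). lra. }
    assert (EQ : Q q = q).
    { set (y := Rmax a (x - e)).
      assert (Hy' : a <= y < x /\ x - e <= y).
      { unfold y. split; [split; [apply Rmax_l | apply Rmax_lub_lt; lra] | apply Rmax_r]. }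
      apply (contraction_bound_unique G y); [apply Hb; lra | apply Hl; lra]. }
    exists e. split; [exact He|]. intros y Hye. rewrite <- EQ. apply Hb. lra. }
(* Here [x > q], yet [[x, x]] is contractible, so [q] is not the bound at [x]. *)
set (x := Rmax a q + 1).
assert (Hx1 := Rmax_l a q). assert (Hx2 := Rmax_r a q).
destruct (Hall x) as [_ H2]; [unfold x; lra|].
destruct (Hloc x) as [e [He Hc]].
apply (H2 x); [unfold x; lra|].
apply (contractible_sub G (x - e) (x + e)); [exact HG | exact Hc | lra | lra].
Qed.

Lemma iter_opp (K : R -> R) n x : Nat.iter n (fun y => - K (- y)) (- x) = - Nat.iter n K x.
Proof.
induction n as [|n IH]; [reflexivity|]. simpl. rewrite IH, Ropp_involutive. reflexivity.
Qed.

Lemma iter_tends_to_fixed_left (K : R -> R) (x a e : R) : lift K -> K x = x -> a < x ->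
  (forall y, a <= y < x -> y < K y) -> 0 < e -> exists n, x - e < Nat.iter n K a < x.
Proof.
intros HK HKx Hax Hy He.
destruct (iter_tends_to_fixed (fun y => - K (- y)) (- x) (- a)) with (eta := e) as [N HN].
- intros y. apply continuity_pt_opp.
  apply (continuity_pt_comp (fun y => - y) K).
  + apply continuity_pt_opp, derivable_continuous_pt, derivable_pt_id.
  + apply lift_continuity, HK.
- intros u v Huv. apply Ropp_lt_contravar, lift_incr; [exact HK | lra].
- rewrite Ropp_involutive, HKx. reflexivity.
- intros y Hya. assert (H := Hy (- y)). lra.
- lra.
- exact He.
- exists N. specialize (HN N (le_n N)). rewrite iter_opp in HN. lra.
Qed.

(* A first fixed point [x] of [K] beyond [q] would attract [[a, y]] for some [y] in [(q, x)],
   making it contractible. *)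
Lemma progress_propagates G K a q : lift_subgroup G -> G K ->
  (forall x, exists e, 0 < e /\ contractible G (x - e) (x + e)) ->
  contraction_bound G a q -> a <= q -> (forall x, a <= x <= q -> x < K x) ->
  forall x, x < K x.
Proof.
intros HG HK Hloc [_ Hq] Haq Hx.
assert (HKl := group_lift G K HG HK).
assert (Hge : forall x, a <= x -> x < K x).
{ apply real_induction. intros x Hax Hl.
  assert (HKx : x < K x).
  { destruct (Rle_lt_dec x q) as [Hxq|Hqx]; [apply Hx; lra|].
    destruct (Rlt_le_dec x (K x)) as [|Hle]; [assumption|]. exfalso.
    assert (E : K x = x).
    { apply Rle_antisym; [exact Hle|].
      destruct (Rle_lt_dec x (K x)) as [|Hlt]; [assumption|]. exfalso.
      set (y := Rmax a (K x)).
      assert (Hy : a <= y < x /\ K x <= y).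
      { unfold y. split; [split; [apply Rmax_l | apply Rmax_lub_lt; lra] | apply Rmax_r]. }
      specialize (Hl y (proj1 Hy)).
      assert (H := lift_incr K HKl y x ltac:(lra)). lra. }
    destruct (Hloc x) as [e [He Hc]].
    destruct (iter_tends_to_fixed_left K x a e HKl E) as [n Hn]; [lra | exact Hl | exact He |].
    set (y := (q + x) / 2).
    apply (Hq y); [unfold y; lra|].
    apply (contractible_preimage G (fun w => Nat.iter n K w));
      [exact HG | apply group_iter; assumption |].
    apply (contractible_sub G (x - e) (x + e)); [exact HG | exact Hc | lra |].
    assert (Hnx : forall m, Nat.iter m K x = x)
      by (induction m as [|m IH]; [reflexivity | simpl; rewrite IH; exact E]).
    assert (H : Nat.iter n K y <= Nat.iter n K x).
    { apply (lift_incr_le (fun w => Nat.iter n K w)); [|unfold y; lra].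
      apply (group_lift G); [exact HG | apply group_iter; assumption]. }
    rewrite Hnx in H. lra. }
  (* For [x <= y < K x], monotonicity gives [y < K x <= K y]. *)
  exists (K x - x). split; [lra|]. intros y Hy.
  assert (H := lift_incr_le K HKl x y (proj1 Hy)). lra. }
intros x. destruct (frac_exists (x - a)) as [k Hk].
specialize (Hge (x + IZR (- k))). rewrite lift_shift, opp_IZR in Hge by exact HKl.
destruct (Rle_lt_dec a (x - IZR k)); lra.
Qed.

(** * Almost-parabolic elements *)

Lemma first_success (P : nat -> Prop) : ~ P 0%nat -> (exists n, P n) ->
  exists j, ~ P j /\ P (S j).
Proof.
intros H0 [n Hn]. induction n as [|n IH]; [contradiction|].
destruct (classic (P n)) as [H|H]; eauto.
Qed.

Section AlmostTranslation.
Context (s b t' c1 c2 c3 d : R) (T : R -> R)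
  (HT : lift T) (Hat : almost_translation s t' c1 c2 c3 d T)
  (Hc1 : 0 < c1) (Hc3 : 0 < c3) (Hd : 0 < d) (Hsb : s < b) (Hbt : b < t').

Let step : 0 < c1 * d. Proof. apply Rmult_lt_0_compat; assumption. Qed.

Lemma almost_translation_iter_passes n : b < Nat.iter (S n) T b.
Proof.
assert (Hb : b < T b) by (destruct Hat as [H _]; specialize (H b); lra).
induction n as [|n IH]; [exact Hb|]. simpl in *.
apply Rlt_trans with (1 := Hb). apply lift_incr; assumption.
Qed.

(** A point at or beyond [b] never returns below [b], so all earlier iterates lie in [[s, b)], where
    each step gains at least [c1 d]. *)
Lemma almost_translation_iter_advance n z : s <= z -> Nat.iter n T z < b ->
  z + INR n * (c1 * d) <= Nat.iter n T z /\
  forall m, (m <= n)%nat -> s <= Nat.iter m T z < b.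
Proof.
intros Hz. induction n as [|n IH]; intros Hn.
- simpl in *. split; [lra|]. intros m Hm. replace m with 0%nat by lia. simpl. lra.
- assert (Hlt : Nat.iter n T z < b).
  { destruct (Rlt_le_dec (Nat.iter n T z) b) as [|Hle]; [assumption|]. exfalso.
    apply (lift_incr_le T HT) in Hle. simpl in Hn.
    assert (H := almost_translation_iter_passes 0). simpl in H. lra. }
  destruct (IH Hlt) as [IH1 IH2]. rewrite S_INR.
  assert (H1 : Nat.iter n T z + c1 * d <= Nat.iter (S n) T z).
  { simpl. specialize (IH2 n (le_n n)). destruct Hat as [H _].
    specialize (H (Nat.iter n T z)). lra. }
  split; [lra|]. intros m Hm. destruct (Nat.eq_dec m (S n)) as [->|Hne].
  + specialize (IH2 n (le_n n)). lra.
  + apply IH2. lia.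
Qed.

(** The orbit of [z] stays below [b] up to time [n] and that of [x] is at most [t' - b] ahead, so
    both remain where the Lipschitz bound of [T] applies. *)
Lemma almost_translation_iter_lipschitz n z x :
  s <= z -> Nat.iter n T z < b -> z <= x ->
  exp (INR (S n) * (c3 * d)) * (x - z) <= t' - b ->
  Nat.iter (S n) T x - Nat.iter (S n) T z <= exp (INR (S n) * (c3 * d)) * (x - z).
Proof.
intros Hz Hn Hzx Hsm.
assert (Hcd : 0 < c3 * d) by (apply Rmult_lt_0_compat; assumption).
destruct (almost_translation_iter_advance n z Hz Hn) as [_ Hrange].
assert (H : forall m, (m <= S n)%nat ->
  0 <= Nat.iter m T x - Nat.iter m T z <= exp (INR m * (c3 * d)) * (x - z)).
{ induction m as [|m IH]; intros Hm.
  - simpl. rewrite Rmult_0_l, exp_0. lra.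
  - destruct IH as [IH1 IH2]; [lia|].
    assert (Hzm := Hrange m ltac:(lia)).
    assert (Hexp : exp (INR m * (c3 * d)) <= exp (INR (S n) * (c3 * d))).
    { destruct (Rle_lt_or_eq_dec (INR m * (c3 * d)) (INR (S n) * (c3 * d))) as [H|H].
      - apply Rmult_le_compat_r; [lra|]. apply le_INR. lia.
      - left. apply exp_increasing, H.
      - rewrite H. lra. }
    assert (Hx : Nat.iter m T x - Nat.iter m T z <= t' - b).
    { apply Rle_trans with (1 := IH2). apply Rle_trans with (2 := Hsm).
      apply Rmult_le_compat_r; lra. }
    destruct Hat as [_ HL]. specialize (HL (Nat.iter m T x) (Nat.iter m T z) ltac:(lra) ltac:(lra)).
    rewrite (Rabs_pos_eq (Nat.iter m T x - _)) in HL by lra. simpl (Nat.iter (S m) _ _).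
    assert (Hle := lift_incr_le T HT (Nat.iter m T z) (Nat.iter m T x) ltac:(lra)).
    rewrite Rabs_pos_eq in HL by lra. split; [lra|].
    apply Rle_trans with (1 := HL). rewrite S_INR, Rmult_plus_distr_r, Rmult_1_l, Rplus_comm, exp_plus.
    rewrite Rmult_assoc. apply Rmult_le_compat_l; [left; apply exp_pos | exact IH2]. }
apply H. lia.
Qed.

(* [K = H^-1 T^(j+1)], where [T^j <= H] somewhere on [[a, b]] but [T^(j+1) > H] on all of it. *)
Lemma almost_parabolic_element G a x0 q H Hi Lam : lift_subgroup G -> G T -> G H -> G Hi ->
  (forall x, exists e, 0 < e /\ contractible G (x - e) (x + e)) ->
  (forall x, Hi (H x) = x) ->
  0 < Lam -> (forall x y, Rabs (Hi x - Hi y) <= Lam * Rabs (x - y)) ->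
  contraction_bound G a q -> s <= a -> a < x0 < b -> b <= q -> x0 < H x0 -> H q < b -> d <= 1 ->
  exists K z, G K /\ (forall x, x < K x) /\ K z - z <= Lam * c2 * d /\
    let E := exp (c3 * (1 + (b - a) / c1)) in
    forall x, z <= x -> E * (x - z) <= t' - b -> K x - K z <= Lam * E * (x - z).
Proof.
intros HG HGT HGH HGHi Hloc E1 HLam HLip Hq Hsa Hx0 Hbq HHx0 HHq Hd1.
assert (HHl := group_lift G H HG HGH). assert (HHil := group_lift G Hi HG HGHi).
assert (HHb : forall z, z <= b -> H z < b).
{ intros z Hz. apply Rle_lt_trans with (2 := HHq). apply lift_incr_le; [exact HHl | lra]. }
destruct (first_success (fun i => forall z, a <= z <= b -> H z < Nat.iter i T z)) as [j [Hnj Hj]].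
- intros Hc. specialize (Hc x0). simpl in Hc. lra.
- destruct (Nat_ceiling ((b - a) / (c1 * d))) as [i Hi']. exists i. intros z Hz.
  destruct (Rlt_le_dec (H z) (Nat.iter i T z)) as [|Hle]; [assumption|]. exfalso.
  assert (Hzb := HHb z (proj2 Hz)).
  destruct (almost_translation_iter_advance i z) as [Hadv _]; [lra | lra|].
  apply (Rmult_lt_compat_r (c1 * d)) in Hi'; [|exact step].
  replace ((b - a) / (c1 * d) * (c1 * d)) with (b - a) in Hi' by (field; lra). lra.
- apply not_all_ex_not in Hnj. destruct Hnj as [z Hnz].
  apply imply_to_and in Hnz. destruct Hnz as [Hz Hle]. apply Rnot_lt_le in Hle.
  assert (Hzb := HHb z (proj2 Hz)).
  assert (HTzb : Nat.iter j T z < b) by lra.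
  destruct (almost_translation_iter_advance j z) as [Hadv Hrange]; [lra | exact HTzb|].
  assert (HTj : lift (fun x => Nat.iter (S j) T x))
    by (apply (group_lift G); [exact HG | apply group_iter; assumption]).
  set (K := fun x => Hi (Nat.iter (S j) T x)).
  assert (HK : G K) by (apply (group_comp G Hi (fun x => Nat.iter (S j) T x) HG HGHi),
    group_iter; assumption).
  exists K, z. split; [exact HK|]. split; [|split].
  + apply (progress_propagates G K a q); try assumption; [lra|]. intros x Hx.
    rewrite <- (E1 x) at 1. apply (lift_incr Hi HHil).
    (* On [[a, b]] this is the choice of [j]; beyond [b],
       [H x <= H q < b < T^(j+1) b <= T^(j+1) x]. *)
    destruct (Rle_lt_dec x b) as [Hxb|Hxb]; [apply Hj; lra|].
    apply Rle_lt_trans with (H q); [apply lift_incr_le; [exact HHl | lra]|].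
    apply Rlt_trans with (1 := HHq).
    apply Rlt_le_trans with (1 := almost_translation_iter_passes j).
    apply (lift_incr_le _ HTj). lra.
  + assert (HTz : T (Nat.iter j T z) <= H z + c2 * d).
    { destruct Hat as [Hat1 _]. specialize (Hat1 (Nat.iter j T z)).
      specialize (Hrange j (le_n j)). lra. }
    destruct Hat as [Hat1 _]. specialize (Hat1 s ltac:(lra)).
    apply (lift_incr_le Hi HHil) in HTz. rewrite <- (E1 z) at 2.
    specialize (HLip (H z + c2 * d) (H z)).
    replace (H z + c2 * d - H z) with (c2 * d) in HLip by ring.
    rewrite (Rabs_pos_eq (c2 * d)) in HLip by lra.
    assert (Hab := Rle_abs (Hi (H z + c2 * d) - Hi (H z))).
    unfold K. simpl. lra.
  + set (E := exp (c3 * (1 + (b - a) / c1))). cbv zeta. intros x Hzx Hsm.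
    (* [T^j z < b] bounds [j c1 d] by [b - a]; the extra step costs [d <= 1]. *)
    assert (HjE : exp (INR (S j) * (c3 * d)) <= E).
    { assert (Hle' : INR (S j) * (c3 * d) <= c3 * (1 + (b - a) / c1)).
      { rewrite S_INR. replace ((INR j + 1) * (c3 * d)) with (c3 * (d + INR j * d)) by ring.
        apply Rmult_le_compat_l; [lra|]. apply Rplus_le_compat; [exact Hd1|].
        apply (Rmult_le_reg_l c1); [exact Hc1|].
        replace (c1 * ((b - a) / c1)) with (b - a) by (field; lra). lra. }
      unfold E. destruct Hle' as [Hlt|Heq]; [left; apply exp_increasing, Hlt | rewrite Heq; lra]. }
    assert (Hxz : exp (INR (S j) * (c3 * d)) * (x - z) <= E * (x - z))
      by (apply Rmult_le_compat_r; lra).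
    assert (HL := almost_translation_iter_lipschitz j z x ltac:(lra) HTzb Hzx ltac:(lra)).
    assert (Hmono := lift_incr_le _ HTj z x Hzx). cbv beta in Hmono.
    specialize (HLip (Nat.iter (S j) T x) (Nat.iter (S j) T z)).
    rewrite (Rabs_pos_eq (Nat.iter (S j) T x - _)) in HLip by lra.
    assert (Hab := Rle_abs (Hi (Nat.iter (S j) T x) - Hi (Nat.iter (S j) T z))).
    unfold K. rewrite Rmult_assoc.
    apply Rle_trans with (1 := Hab). apply Rle_trans with (1 := HLip).
    apply Rmult_le_compat_l; lra.
Qed.

End AlmostTranslation.

(** The displacements [u m] of [K^m z] satisfy [u (m + 1) <= Lam c d + Lam E (u m)], and
    [d (W^m - 1)] dominates this recursion; the bound on [d W^M] keeps the iterates where the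
    Lipschitz estimate holds. *)
Lemma iter_small_displacement (K : R -> R) (z E Lam c d delta W : R) (M : nat) :
  (forall x, x < K x) -> 0 < E -> 0 < Lam -> 0 < c -> 0 < d ->
  K z - z <= Lam * c * d ->
  (forall x, z <= x -> E * (x - z) <= delta -> K x - K z <= Lam * E * (x - z)) ->
  W = 1 + Lam * E + Lam * c -> E * (d * W ^ M) <= delta ->
  forall m, (m <= M)%nat -> Nat.iter m K z - z <= d * (W ^ m - 1).
Proof.
intros HK HE HLam Hc Hd Hz HL HW HM.
assert (HLE : 0 < Lam * E) by (apply Rmult_lt_0_compat; assumption).
assert (HLc : 0 < Lam * c) by (apply Rmult_lt_0_compat; assumption).
assert (HW1 : 1 <= W) by lra.
induction m as [|m IH]; intros Hm; [simpl; lra|].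
specialize (IH ltac:(lia)). set (x := Nat.iter m K z) in *.
assert (Hzx : z <= x).
{ destruct m as [|m']; [unfold x; simpl; lra|]. left. apply iter_gt; [exact HK | lia]. }
assert (HWm : W ^ m <= W ^ M) by (apply Rle_pow; [exact HW1 | lia]).
assert (HWp : 1 <= W ^ m) by (apply pow_R1_Rle; exact HW1).
assert (Hsm : E * (x - z) <= delta).
{ apply Rle_trans with (2 := HM). apply Rmult_le_compat_l; [lra|].
  apply Rle_trans with (1 := IH). apply Rmult_le_compat_l; lra. }
specialize (HL x Hzx Hsm). change (Nat.iter (S m) K z) with (K x). simpl (W ^ S m).
assert (H1 : Lam * E * (x - z) <= Lam * E * (d * (W ^ m - 1)))
  by (apply Rmult_le_compat_l; lra).
assert (H2 : d * (Lam * c) <= d * (Lam * c * W ^ m)).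
{ apply Rmult_le_compat_l; [lra|]. rewrite <- (Rmult_1_r (Lam * c)) at 1.
  apply Rmult_le_compat_l; lra. }
assert (H3 : 0 <= d * (Lam * E)) by (apply Rmult_le_pos; lra).
assert (H4 : 0 <= d * (W ^ m - 1)) by (apply Rmult_le_pos; lra).
replace (d * (W * W ^ m - 1)) with
  (Lam * E * (d * (W ^ m - 1)) + d * (Lam * E) + d * (Lam * c * W ^ m) + d * (W ^ m - 1))
  by (rewrite HW; ring).
lra.
Qed.

(** * From a finite rotation image to a finite orbit *)

Lemma finite_rotation_image_finite_orbit G : lift_subgroup G -> C1_nondiscrete G ->
  finite_rotation_image G -> has_finite_orbit G.
Proof.
intros HG HC1 HR. apply NNPP; intros Hno.
destruct (near_identity_fixed_point G HG HR) as [eps [Heps Hfix]].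
destruct (near_identity_pair G HG HC1 eps Heps) as [f [_ [Hf [_ [_ [_ [Hfn [Nf _]]]]]]]].
destruct (Hfix f Hf Nf) as [e0 He0].
destruct (contracting_pair_exists G (fun _ => True) f HG Hno) as
  [z0 [s [t [phi1 [phi2 [p1 [p2 [_ [Hz [Hts [G1 [G2 [C1 [C2 [P1 [P2 [E1 [E2 Hne]]]]]]]]]]]]]]]]]];
  [split; auto | exact Hf | exact Hfn | eauto |].
destruct (local_translations G s t phi1 phi2 p1 p2 HG HC1 Hts G1 G2 C1 C2 P1 P2 E1 E2 Hne)
  as [c1 [c2 [c3 [Hc1 [Hc2 [Hc3 HT]]]]]].
assert (Hst : s < t) by lra.
assert (Hcst := contracted_interval_contractible G s t phi1 p1 HG HC1 Hno Hts Hst G1 C1 P1 E1).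
assert (Hloc := locally_contractible G s t HG HC1 Hno Hst Hcst).
destruct (contraction_bound_exists G s HG) as [q Hq];
  [apply (contractible_sub G s t); [exact HG | exact Hcst | lra | lra] |].
destruct (contraction_bound_not_constant G s t q HG HC1 Hno Hst Hcst Hq) as [x0 [Hx0 Hcx0]].
set (b := (x0 + t) / 2). set (t' := (b + t) / 2).
assert (Hb : x0 < b /\ b < t' /\ t' < t) by (unfold t', b; lra).
assert (Hbq : b <= q).
{ destruct (Rle_lt_dec b q) as [|Hlt]; [assumption|]. exfalso. apply (proj2 Hq b Hlt).
  apply (contractible_sub G s t); [exact HG | exact Hcst | lra | lra]. }
(* Contracting [[x0, q]] into [(x0, b)] gives both inequalities required of [H]. *)
destruct (Hcx0 x0 b) as [H [HH [HHx0 HHq]]]; [lra|].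
destruct (group_inv G H HG HH) as [Hi [HHi [EH1 _]]].
destruct (lift_lipschitz Hi (group_lift G Hi HG HHi)) as [Lam [HLam HLip]].
destruct (uniform_progress G HG HR) as [M HM].
destruct (HT t') as [d0 [Hd0 HTd]]; [lra|].
set (E := exp (c3 * (1 + (b - s) / c1))).
assert (HE : 0 < E) by apply exp_pos.
set (W := 1 + Lam * E + Lam * c2).
assert (HW : 1 <= W).
{ assert (A1 := Rmult_lt_0_compat _ _ HLam HE). assert (A2 := Rmult_lt_0_compat _ _ HLam Hc2).
  unfold W. lra. }
assert (HWM : 1 <= W ^ M) by (apply pow_R1_Rle; exact HW).
assert (HEW : 0 < E * W ^ M) by (apply Rmult_lt_0_compat; lra).
(* [M], [E] and [W] are fixed before [d]. The four bounds give the existence of [T], the validity of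
   [E], the range of the Lipschitz estimate, and [d W^M <= 1 / 2], so that [K^M] moves [z] by less
   than 1. *)
set (d := Rmin (Rmin (d0 / 2) 1) (Rmin ((t' - b) / (E * W ^ M)) (1 / (2 * W ^ M)))).
assert (Hd : 0 < d).
{ repeat apply Rmin_pos; try apply Rdiv_lt_0_compat; lra. }
assert (Hd1 : d <= d0 / 2 /\ d <= 1).
{ assert (A := Rmin_l (Rmin (d0 / 2) 1) (Rmin ((t' - b) / (E * W ^ M)) (1 / (2 * W ^ M)))).
  fold d in A. split; apply Rle_trans with (1 := A); [apply Rmin_l | apply Rmin_r]. }
assert (Hd2 : d <= (t' - b) / (E * W ^ M) /\ d <= 1 / (2 * W ^ M)).
{ assert (A := Rmin_r (Rmin (d0 / 2) 1) (Rmin ((t' - b) / (E * W ^ M)) (1 / (2 * W ^ M)))).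
  fold d in A. split; apply Rle_trans with (1 := A); [apply Rmin_l | apply Rmin_r]. }
destruct Hd1 as [Hdd0 Hd1]. destruct Hd2 as [Hd2 Hd3].
destruct (HTd d) as [T [HGT Hat]]; [lra|].
destruct (almost_parabolic_element s b t' c1 c2 c3 d T (group_lift G T HG HGT) Hat Hc1 Hc3 Hd
  ltac:(lra) ltac:(lra) G s x0 q H Hi Lam HG HGT HH HHi Hloc EH1 HLam HLip Hq)
  as [K [z [HK [HKp [HKz HKL]]]]]; try lra.
cbv zeta in HKL. fold E in HKL.
assert (Hfin := iter_small_displacement K z E Lam c2 d (t' - b) W M HKp HE HLam Hc2 Hd HKz HKL eq_refl).
apply (Rmult_le_compat_r (E * W ^ M)) in Hd2; [|lra].
replace ((t' - b) / (E * W ^ M) * (E * W ^ M)) with (t' - b) in Hd2 by (field; lra).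
specialize (Hfin ltac:(lra) M (le_n M)).
apply (Rmult_le_compat_r (W ^ M)) in Hd3; [|lra].
replace (1 / (2 * W ^ M) * W ^ M) with (1 / 2) in Hd3 by (field; lra).
specialize (HM K HK HKp z). lra.
Qed.

Theorem theorem1p2 (G : (R -> R) -> Prop) :
  lift_subgroup G -> C1_nondiscrete G ->
  (finite_rotation_image G <-> has_finite_orbit G).
Proof.
intros HG HC1. split.
- apply finite_rotation_image_finite_orbit; assumption.
- apply finite_orbit_finite_rotation_image; assumption.
Qed.
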